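(* Let $n \ge 1$, let $T \in \mathcal{B}(\mathbb{C}^n) \simeq \mathbb{M}_n(\mathbb{C})$ and suppose that $\mathrm{tr}(T) = r$ is a non-negative integer. The following are equivalent: (a) $T \in \overline{\mathfrak{E}-\mathfrak{E}}$, the norm-closure in $\mathcal{B}(\mathbb{C}^n)$ of the set of differences of idempotents; (b) $T$ is similar to a direct sum $B \oplus Z$, where $B$ is balanced, $\sigma(Z)\subseteq\{-1,1\}$ and $\dim\ker(Z-I)\ge r$.
   Context: $\mathfrak{E} := \{E \in \mathcal{B}(\mathbb{C}^n) : E^2=E\}$ and $\mathfrak{E}-\mathfrak{E} := \{E-F : E,F\in\mathfrak{E}\}$. In (b), $B$ and $Z$ act on finite-dimensional complex Hilbert spaces whose dimensions add up to $n$; either of the two summands is allowed to act on the zero space (i.e. to be absent). Balanced operators: for an operator $T \in \mathcal{B}(\mathcal{H})$ and an open set $\Omega \subseteq \mathbb{C}$ such that $\sigma(T)\cap\Omega$ is relatively closed and open in $\sigma(T)$, $\mathcal{H}(\Omega;T)$ denotes the range of the Riesz idempotent of $T$ corresponding to $\sigma(T)\cap\Omega$. $T - \alpha I$ is semi-Fredholm if its range is closed and $\min(\dim\ker(T-\alpha I), \dim\ker(T-\alpha I)^* ) < \infty$, in which case $\mathrm{Ind}(T-\alpha I) := \dim\ker(T-\alpha I) - \dim\ker(T-\alpha I)^*$. The operator $T$ is called balanced if: (i) $\sigma(T) = \sigma(-T)$; (ii) whenever $\Omega_1,\Omega_2\subseteq\mathbb{C}$ are disjoint open sets with $\sigma(T)\subseteq\Omega_1\cup\Omega_2$,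 one has $\dim\mathcal{H}(\Omega_1;T) = \dim\mathcal{H}(-\Omega_1;T)$; (iii) for $\alpha\in\mathbb{C}$, $T-\alpha I$ is semi-Fredholm if and only if $T+\alpha I$ is semi-Fredholm, in which case $\mathrm{Ind}(T-\alpha I) = \mathrm{Ind}(T+\alpha I)$. *)

(* Defs.v *)
From HB Require Import structures.
From mathcomp Require Import all_boot all_order all_algebra.
From mathcomp Require Import complex.
From mathcomp Require Import all_classical all_reals all_analysis.

Set Implicit Arguments.
Unset Strict Implicit.
Unset Printing Implicit Defensive.

Import Order.TTheory GRing.Theory Num.Theory numFieldNormedType.Exports.

Local Open Scope classical_set_scope.
Local Open Scope complex_scope.
Local Open Scope ring_scope.
Local Open Scope sesquilinear_scope.

(* A matrix A : 'M[R[i]]_n is identified with the operator x |-> A *m x on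
   column vectors. *)

Definition idempotent_mx (R : realType) (n : nat) : set 'M[R[i]]_n :=
  [set E | E *m E = E].

Definition diff_idempotent_mx (R : realType) (n : nat) : set 'M[R[i]]_n :=
  [set E - F | E in @idempotent_mx R n & F in @idempotent_mx R n].

Definition l2norm (R : realType) (n : nat) (x : 'cV[R[i]]_n) : R :=
  Num.sqrt (\sum_(i < n) Normc.normc (x i 0) ^+ 2).

Definition opnorm (R : realType) (n : nat) (A : 'M[R[i]]_n) : R :=
  sup [set l2norm (A *m x) | x in [set x : 'cV[R[i]]_n | l2norm x <= 1]].

Definition norm_closure (R : realType) (n : nat) (S : set 'M[R[i]]_n) :
    set 'M[R[i]]_n :=
  [set A | forall eps : R, 0 < eps -> exists2 X, S X & opnorm (A - X) < eps].

Definition spectrum (R : realType) (n : nat) (A : 'M[R[i]]_n) : set R[i] :=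
  [set a | A - a%:M \notin unitmx].

(* kermx is the left kernel, hence the transpose. *)
Definition dimker (R : realType) (n : nat) (A : 'M[R[i]]_n) : nat :=
  \rank (kermx A^T).

Definition oppset (R : realType) (Omega : set R[i]) : set R[i] :=
  [set - z | z in Omega].

Definition cis (R : realType) (t : R) : R[i] := cos t +i* sin t.

Definition circle (R : realType) (a : R[i]) (rho t : R) : R[i] :=
  a + rho%:C * cis t.

Definition cintegral (R : realType) (a b : R) (g : R -> R[i]) : R[i] :=
  Rintegral (@lebesgue_measure R) `[a, b] (fun t => complex.Re (g t)) +i*
  Rintegral (@lebesgue_measure R) `[a, b] (fun t => complex.Im (g t)).

(* The integral of f(z) dz along the positively oriented circle |z - a| = rho,
   with dz = i rho e^{it} dt. *)
Definition circle_integral (R : realType) (f : R[i] -> R[i]) (a : R[i])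
    (rho : R) : R[i] :=
  cintegral 0 (2 * pi) (fun t => f (circle a rho t) * ('i%C * rho%:C * cis t)).

(* rho is small enough for the closed discs of radius rho around the points of
   the spectrum to be pairwise disjoint. *)
Definition separating_radius (R : realType) (n : nat) (A : 'M[R[i]]_n)
    (rho : R) : Prop :=
  0 < rho /\
  forall a b, spectrum A a -> spectrum A b -> a <> b ->
    rho + rho < Normc.normc (a - b).

Definition riesz_radius (R : realType) (n : nat) (A : 'M[R[i]]_n) : R :=
  xget 1 [set rho | separating_radius A rho].

(* (2 pi i)^-1 times the integral of the resolvent (z - A)^-1 along a contour
   around the part of the (finite) spectrum lying in Omega.  The contour is a
   union of small circles, one around each point of spectrum A `&` Omega; by
   Cauchy's theorem the choice of their common radius is irrelevant. *)
Definition riesz_idempotent (R : realType) (n : nat) (A : 'M[R[i]]_n)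
    (Omega : set R[i]) : 'M[R[i]]_n :=
  \sum_(a \in spectrum A `&` Omega)
    \matrix_(i, j) ((2 * pi%:C * 'i%C)^-1 *
      circle_integral (fun z => invmx (z%:M - A) i j) a (riesz_radius A)).

(* dim H(Omega; A) *)
Definition riesz_dim (R : realType) (n : nat) (A : 'M[R[i]]_n)
    (Omega : set R[i]) : nat :=
  \rank (riesz_idempotent A Omega).

(* R[i]^o carries the usual topology of the complex plane. *)
Definition semi_fredholm (R : realType) (n : nat) (A : 'M[R[i]]_n) : Prop :=
  closed ([set A *m x | x in [set: 'cV[R[i]]_n]] : set 'cV[R[i]^o]_n) /\
  (Order.min (dimker A)%:R%:E (dimker (A ^t*))%:R%:E < +oo :> \bar R)%E.

Definition fredholm_index (R : realType) (n : nat) (A : 'M[R[i]]_n) : int :=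
  (dimker A)%:Z - (dimker (A ^t*))%:Z.

Definition balanced (R : realType) (n : nat) (A : 'M[R[i]]_n) : Prop :=
  [/\ spectrum A = spectrum (- A),
      forall Omega1 Omega2 : set R[i],
        open (Omega1 : set R[i]^o) -> open (Omega2 : set R[i]^o) ->
        Omega1 `&` Omega2 = set0 -> spectrum A `<=` Omega1 `|` Omega2 ->
        riesz_dim A Omega1 = riesz_dim A (oppset Omega1)
    & forall a : R[i],
        (semi_fredholm (A - a%:M) <-> semi_fredholm (A + a%:M)) /\
        (semi_fredholm (A - a%:M) ->
          fredholm_index (A - a%:M) = fredholm_index (A + a%:M))].

(* Main.v *)
Require Import Defs.
From mathcomp Require Import all_boot all_order all_algebra.
From mathcomp Require Import complex ring lra.
From mathcomp Require Import all_classical all_reals all_analysis.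

Set Implicit Arguments.
Unset Strict Implicit.
Unset Printing Implicit Defensive.

Import Order.TTheory GRing.Theory Num.Theory numFieldNormedType.Exports.

Local Open Scope classical_set_scope.
Local Open Scope complex_scope.
Local Open Scope ring_scope.

(** The idempotents E and F satisfy a hidden symmetry.  Factor E = C R and
F = W Y through their ranks e and f, with R C = 1 and Y W = 1.  Two uses of
det (1 - X Y) = det (1 - Y X) give, for t away from 0 and 1,
  det (t - (E - F)) = t^(n-e-f) (t - 1)^(e-f) det ((t^2 - 1) + Y E W),
where the last factor depends on t^2 only.  With r = tr (E - F) = e - f, the
characteristic polynomial of X = E - F is therefore (t - 1)^r times a
polynomial whose roots are symmetric under negation; moreover
X - 1 = (E - 1) - F has rank at most n - r.  The trace of E - F is an integer,
so it equals r as soon as E - F is close to a matrix T of trace r, and both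
facts are closed conditions: they pass to T in the closure
([closure_necessary]).  Splitting T along the eigenvalues different from
1, -1 and those equal to 1 or -1 produces B and Z.

Conversely, if T is similar to B (+) Z then the trace forces the eigenvalues
of T to be r copies of 1 together with a symmetric list s, and the kernel
condition lets r eigenvectors for 1 be split off: T is similar to
[[M, C], [0, 1_r]] where M has the eigenvalues s.  The matrix M is brought to
block triangular form with diagonal blocks diag (-l, l) (and one 0 if the size
is odd).  Moving each l slightly makes all the blocks have disjoint spectra,
different from 1; the off-diagonal blocks can then be removed by a similarity,
and each diag (-l, l) is a difference of two rank-one idempotents
([approx_symmetric], [closure_of_eigenlist]).

The link with balanced matrices is that the Riesz idempotent attached to an
open set has as rank the number of eigenvalues in that set, counted with
multiplicity ([riesz_dimE]).  The resolvent is a finite sum of terms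
(z - a)^-(k+1) N_(a,k), where N_(a,0) is a polynomial in the matrix that
projects onto the generalized eigenspace of a; integration over small circles
leaves exactly these projections.  Hence a matrix is balanced if and only if
its list of eigenvalues is invariant under negation ([balancedP]), the
semi-Fredholm condition being automatic in finite dimension. *)

(** * Similarity of square matrices *)

(** The two sizes may be different terms: this avoids casts when blocks are
reassociated, and equality of the sizes is a consequence. *)
Definition similar_mx (K : fieldType) (n m : nat) (A : 'M[K]_n) (B : 'M[K]_m) :=
  exists (P : 'M[K]_(m, n)) (Q : 'M[K]_(n, m)),
    [/\ P *m Q = 1%:M, Q *m P = 1%:M & P *m A = B *m P].

Section Similarity.
Variable K : fieldType.

Lemma similar_refl n (A : 'M[K]_n) : similar_mx A A.
Proof. by exists 1%:M, 1%:M; rewrite !mulmx1 !mul1mx. Qed.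

Lemma similar_sym n m (A : 'M[K]_n) (B : 'M[K]_m) : similar_mx A B -> similar_mx B A.
Proof.
move=> [P [Q [PQ QP PA]]]; exists Q, P; split=> //.
by rewrite -[LHS]mulmx1 -PQ mulmxA -(mulmxA Q) -PA !mulmxA QP mul1mx.
Qed.

Lemma similar_trans n m k (A : 'M[K]_n) (B : 'M[K]_m) (C : 'M[K]_k) :
  similar_mx A B -> similar_mx B C -> similar_mx A C.
Proof.
move=> [P [Q [PQ QP PA]]] [P' [Q' [PQ' QP' PA']]]; exists (P' *m P), (Q *m Q').
split; first by rewrite -mulmxA (mulmxA P) PQ mul1mx.
  by rewrite -mulmxA (mulmxA Q') QP' mul1mx.
by rewrite -mulmxA PA mulmxA PA' -mulmxA.
Qed.

Lemma similar_dim n m (A : 'M[K]_n) (B : 'M[K]_m) : similar_mx A B -> n = m.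
Proof.
move=> [P [Q [PQ QP _]]]; apply/eqP; rewrite eqn_leq; apply/andP; split.
  by rewrite -(mxrank1 K n) -QP (leq_trans (mxrankM_maxr _ _)) ?rank_leq_row.
by rewrite -(mxrank1 K m) -PQ (leq_trans (mxrankM_maxr _ _)) ?rank_leq_row.
Qed.

Lemma similar_cast n m (e : n = m) (A : 'M[K]_n) : similar_mx A (castmx (e, e) A).
Proof. by case: m / e; rewrite castmx_id; apply: similar_refl. Qed.

Lemma similar_unitP n (A B : 'M[K]_n) :
  similar_mx A B <-> exists2 P, P \in unitmx & P *m A = B *m P.
Proof.
split=> [[P [Q [PQ QP PA]]]|[P Pu PA]].
  by exists P => //; case: (mulmx1_unit PQ).
by exists P, (invmx P); rewrite mulmxV ?mulVmx.
Qed.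

Lemma similar_simmx n (A B : 'M[K]_n) : simmx_in unitmx A B <-> similar_mx A B.
Proof.
split=> [[P Pu /(simmxP Pu) PA]|/similar_unitP[P Pu PA]].
  by apply/similar_unitP; exists P.
by exists P => //; apply/(simmxP Pu).
Qed.

Lemma char_poly_similar n m (A : 'M[K]_n) (B : 'M[K]_m) :
  similar_mx A B -> char_poly A = char_poly B.
Proof.
move=> sAB; have e := similar_dim sAB; case: m / e B sAB => B.
move/similar_unitP=> [P Pu PA].
have: map_mx polyC P *m char_poly_mx A = char_poly_mx B *m map_mx polyC P.
  rewrite /char_poly_mx mulmxBr mulmxBl -!map_mxM PA; congr (_ - _).
  by rewrite scalar_mxC.
move/(congr1 determinant); rewrite !det_mulmx mulrC; apply: mulIf.
by rewrite det_map_mx polyC_eq0 -unitfE -unitmxE.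
Qed.

Lemma similar_shift n m (A : 'M[K]_n) (B : 'M[K]_m) a :
  similar_mx A B -> similar_mx (A - a%:M) (B - a%:M).
Proof.
move=> [P [Q [PQ QP PA]]]; exists P, Q; split=> //.
by rewrite mulmxBr mulmxBl PA scalar_mxC.
Qed.

Lemma similar_rank n m (A : 'M[K]_n) (B : 'M[K]_m) :
  similar_mx A B -> \rank A = \rank B.
Proof.
move=> sAB; have e := similar_dim sAB; case: m / e B sAB => B.
move/similar_unitP=> [P Pu PA].
rewrite -(mxrankMfree B (_ : row_free P)) ?row_free_unit // -PA.
by rewrite (eqmxMfull _ _) ?row_full_unit.
Qed.

Lemma similar_ublock n n' m m' (A : 'M[K]_n) (A' : 'M[K]_n') (D : 'M[K]_m)
    (D' : 'M[K]_m') (C : 'M[K]_(n, m)) :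
  similar_mx A A' -> similar_mx D D' ->
  exists C', similar_mx (block_mx A C 0 D) (block_mx A' C' 0 D').
Proof.
move=> [P [Q [PQ QP PA]]] [P' [Q' [PQ' QP' PD]]]; exists (P *m C *m Q').
exists (block_mx P 0 0 P'), (block_mx Q 0 0 Q').
rewrite !mulmx_block !mulmx0 !mul0mx !addr0 !add0r PQ QP PQ' QP' PA PD.
by rewrite -mulmxA QP' mulmx1 -!scalar_mx_block.
Qed.

Lemma similar_dblock n n' m m' (A : 'M[K]_n) (A' : 'M[K]_n') (D : 'M[K]_m)
    (D' : 'M[K]_m') :
  similar_mx A A' -> similar_mx D D' ->
  similar_mx (block_mx A 0 0 D) (block_mx A' 0 0 D').
Proof.
move=> [P [Q [PQ QP PA]]] [P' [Q' [PQ' QP' PD]]].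
exists (block_mx P 0 0 P'), (block_mx Q 0 0 Q').
rewrite !mulmx_block !mulmx0 !mul0mx !addr0 !add0r PQ QP PQ' QP' PA PD.
by rewrite -!scalar_mx_block.
Qed.

(** Conjugation by the unipotent block matrix [[1, - Y], [0, 1]]. *)
Lemma similar_coboundary n m (A : 'M[K]_n) (D : 'M[K]_m) (C Y : 'M[K]_(n, m)) :
  similar_mx (block_mx A C 0 D) (block_mx A (C + A *m Y - Y *m D) 0 D).
Proof.
exists (block_mx 1%:M (- Y) 0 1%:M), (block_mx 1%:M Y 0 1%:M).
rewrite !mulmx_block !mulmx0 !mul0mx !addr0 !add0r !mulmx1 !mul1mx.
rewrite !scalar_mx_block subrr addNr; split=> //; congr block_mx.
by rewrite mulmxN mulNmx addrA (addrC _ (C + _)) addrK.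
Qed.

(** Against a scalar block the Sylvester equation A Y - Y a + C = 0 is solved
by the resolvent: Y = - (A - a)^-1 C. *)
Lemma similar_decouple n m (A : 'M[K]_n) (C : 'M[K]_(n, m)) a :
  A - a%:M \in unitmx ->
  similar_mx (block_mx A C 0 (@scalar_mx K m a)) (block_mx A 0 0 (@scalar_mx K m a)).
Proof.
move=> Au; have := similar_coboundary A a%:M C (- (invmx (A - a%:M) *m C)).
rewrite scalar_mxC -addrA -mulmxBl mulmxN mulmxA mulmxV // mul1mx subrr.
by [].
Qed.

Lemma char_poly_ublock n m (A : 'M[K]_n) (C : 'M[K]_(n, m)) (D : 'M[K]_m) :
  char_poly (block_mx A C 0 D) = char_poly A * char_poly D.
Proof.
rewrite /char_poly /char_poly_mx map_block_mx scalar_mx_block opp_block_mx.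
by rewrite add_block_mx map_mx0 subr0 det_ublock.
Qed.

Lemma char_poly_scalar r (a : K) : char_poly (@scalar_mx K r a) = ('X - a%:P) ^+ r.
Proof.
by rewrite /char_poly /char_poly_mx map_scalar_mx -raddfB /= det_scalar.
Qed.

Lemma horner_char_poly n (A : 'M[K]_n) a : (char_poly A).[a] = \det (a%:M - A).
Proof.
rewrite -horner_evalE /char_poly -det_map_mx /char_poly_mx; congr (\det _).
by apply/matrixP=> i j; rewrite !mxE /= /horner_eval !hornerE hornerMn hornerX.
Qed.

Lemma unitmx_subP n (A : 'M[K]_n) a :
  (A - a%:M \in unitmx) = ~~ root (char_poly A) a.
Proof.
rewrite unitmxE unitfE; congr (~~ _); rewrite /root horner_char_poly.
by rewrite -opprB -scaleN1r detZ mulf_eq0 expf_eq0 oppr_eq0 oner_eq0 andbF.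
Qed.

(** A matrix N of rank at most m is, up to an invertible factor on the left,
a matrix whose last r rows vanish; conjugating N = A - a by that factor keeps
these rows zero, and adding a back gives the block a%:M. *)
Lemma similar_deflate (m r : nat) (A : 'M[K]_(m + r)) a : (\rank (A - a%:M)%R <= m)%N ->
  exists (M : 'M[K]_m) (C : 'M[K]_(m, r)), similar_mx A (block_mx M C 0 a%:M).
Proof.
move=> rk; set N := A - a%:M in rk *.
(* L is the inverse of the column transformation of Gaussian elimination. *)
have [L [N' [Lu [LN N'd]]]] : exists L N', L \in unitmx /\ L *m N = N' *m L
    /\ dsubmx N' = 0.
  exists (invmx (col_ebase N)).
  exists (pid_mx (\rank N) *m row_ebase N *m col_ebase N); split.
    by rewrite unitmx_inv col_ebase_unit.
  split.
    rewrite -{2}(mulmx_ebase N) -!mulmxA mulmxV ?col_ebase_unit //.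
    by rewrite mulKmx ?col_ebase_unit // mulmx1.
  rewrite -mulmxA -mul_dsub_mx.
  suff -> : dsubmx (pid_mx (\rank N) : 'M[K]_(m + r)) = 0 by rewrite mul0mx.
  apply/matrixP=> i j; rewrite !mxE /=.
  by rewrite ltnNge (leq_trans rk) ?leq_addr // andbF.
exists (ulsubmx N' + a%:M), (ursubmx N').
apply: (@similar_trans _ _ _ _ (N' + a%:M)).
  apply/similar_unitP; exists L => //.
  by rewrite mulmxDl -LN mulmxBr scalar_mxC subrK.
rewrite -[N' in N' + _]submxK; have -> : dlsubmx N' = 0.
  by rewrite /dlsubmx N'd; apply/matrixP=> i j; rewrite !mxE.
have -> : drsubmx N' = 0.
  by rewrite /drsubmx N'd; apply/matrixP=> i j; rewrite !mxE.
by rewrite scalar_mx_block add_block_mx !add0r addr0; apply: similar_refl.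
Qed.

End Similarity.

(** * Eigenvalues with multiplicity *)

Definition eigenlist (K : fieldType) n (A : 'M[K]_n) (s : seq K) :=
  char_poly A = \prod_(a <- s) ('X - a%:P).

Section Eigenlist.
Variable K : fieldType.

Lemma eigenlist_size n (A : 'M[K]_n) s : eigenlist A s -> n = size s.
Proof.
by move/(congr1 (size \o @polyseq K)); rewrite /= size_char_poly size_prod_XsubC => -[].
Qed.

Lemma eigenlist_similar n m (A : 'M[K]_n) (B : 'M[K]_m) s :
  similar_mx A B -> eigenlist A s <-> eigenlist B s.
Proof. by move=> /char_poly_similar sAB; rewrite /eigenlist sAB. Qed.

Lemma eigenlist_perm n (A : 'M[K]_n) s t :
  eigenlist A s -> eigenlist A t <-> perm_eq s t.
Proof.
rewrite /eigenlist => ->; split=> [/prod_XsubC_eq //|/(perm_big _) -> //].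
Qed.

Lemma eigenlist_ublock n m (A : 'M[K]_n) (C : 'M[K]_(n, m)) (D : 'M[K]_m) s t :
  eigenlist A s -> eigenlist D t -> eigenlist (block_mx A C 0 D) (s ++ t).
Proof. by rewrite /eigenlist char_poly_ublock big_cat => -> ->. Qed.

Lemma eigenlist_scalar r (a : K) : eigenlist (@scalar_mx K r a) (nseq r a).
Proof. by rewrite /eigenlist char_poly_scalar big_nseq -Monoid.iteropE. Qed.

Lemma eigenlist_unit n (A : 'M[K]_n) s a :
  eigenlist A s -> (A - a%:M \in unitmx) = (a \notin s).
Proof. by move=> As; rewrite unitmx_subP As root_prod_XsubC. Qed.

(** Any eigenvalue of the list can be chosen as the last diagonal entry of a
block triangular form; iterating this gives triangular forms with the
eigenvalues in a prescribed order. *)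
Lemma eigenlist_peel n (A : 'M[K]_n) a s : eigenlist A (a :: s) ->
  exists (m : nat) (M : 'M[K]_m) (C : 'M[K]_(m, 1)),
    similar_mx A (block_mx M C 0 (@scalar_mx K 1 a)) /\ eigenlist M s.
Proof.
move=> As; have := eigenlist_size As; rewrite /= -addn1 => e.
subst n; have rk : (\rank (A - a%:M)%R <= size s)%N.
  have : (\rank (A - a%:M)%R <= (size s).+1)%N by rewrite (leq_trans (rank_leq_row _)) ?addn1.
  rewrite leq_eqVlt ltnS => /orP[/eqP full|//].
  have: A - a%:M \in unitmx by rewrite -row_free_unit /row_free full addn1.
  by rewrite (eigenlist_unit _ As) mem_head.
have [M [C sAM]] := similar_deflate rk; exists (size s), M, C; split=> //.
have /(eigenlist_similar _ sAM) := As.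
rewrite /eigenlist char_poly_ublock char_poly_scalar expr1 big_cons mulrC.
by apply: mulfI; rewrite polyXsubC_eq0.
Qed.

Lemma similar_blockA n1 n2 n3 (A : 'M[K]_n1) (B : 'M[K]_n2) (D : 'M[K]_n3)
    (C1 : 'M[K]_(n1, n3)) (C2 : 'M[K]_(n2, n3)) (C : 'M[K]_(n1, n2)) :
  similar_mx (block_mx (block_mx A C 0 B) (col_mx C1 C2) 0 D)
          (block_mx A (row_mx C C1) 0 (block_mx B C2 0 D)).
Proof.
have -> : 0 = row_mx 0 0 :> 'M[K]_(n3, n1 + n2) by rewrite row_mx0.
have -> : 0 = col_mx 0 0 :> 'M[K]_(n2 + n3, n1) by rewrite col_mx0.
by rewrite block_mxA; apply: similar_cast.
Qed.

(** Primary decomposition.  The eigenvalues in t are peeled off one by one;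
each of them is absent from s, so the column that couples it to the block B
can be removed. *)
Lemma disjoint_split n (A : 'M[K]_n) s t :
  eigenlist A (s ++ t) -> {in t, forall a, a \notin s} ->
  exists (m k : nat) (B : 'M[K]_m) (Z : 'M[K]_k),
    [/\ similar_mx A (block_mx B 0 0 Z), eigenlist B s & eigenlist Z t].
Proof.
elim: t n A => [|a t IH] n A.
  rewrite cats0 => As _; exists n, 0, A, 0; split=> //.
    exists (col_mx 1%:M 0), (row_mx 1%:M 0); split.
    - rewrite mul_col_row !mulmx0 !mul0mx mulmx1 scalar_mx_block.
      by congr block_mx; rewrite [RHS]thinmx0.
    - by rewrite mul_row_col mulmx0 mulmx1 addr0.
    - by rewrite mul_col_mx mul_block_col mul1mx !mul0mx mulmx1 !addr0.
  by rewrite /eigenlist /char_poly det_mx00 big_nil.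
move=> As dj; have [|m [M [C [sAM Ms]]]] := @eigenlist_peel _ A a (s ++ t).
  by apply/(eigenlist_perm _ As); rewrite -[a :: t]cat1s perm_catCA.
have [//|x xt|m1 [k1 [B [Z [sM Bs Zt]]]]] := IH _ M.
  by apply: dj; rewrite inE xt orbT.
have [C' sC] := similar_ublock C sM (similar_refl (@scalar_mx K 1 a)).
exists m1, (k1 + 1)%N, B, (block_mx Z (dsubmx C') 0 a%:M); split=> //.
  apply: similar_trans sAM (similar_trans sC _).
  (* Only the rows of C' facing B are removed. *)
  set Y := - (invmx (B - a%:M) *m usubmx C').
  have Bu : B - a%:M \in unitmx by rewrite (eigenlist_unit _ Bs) dj ?mem_head.
  apply: similar_trans (similar_coboundary _ _ _ (col_mx Y 0)) _.
  suff -> : C' + block_mx B 0 0 Z *m col_mx Y 0 - col_mx Y 0 *m a%:M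
            = col_mx 0 (dsubmx C').
    by have := similar_blockA B Z (@scalar_mx K 1 a) 0 (dsubmx C') 0; rewrite row_mx0.
  rewrite -{1}[C']vsubmxK mul_block_col mul_col_mx !mulmx0 !mul0mx !addr0.
  rewrite opp_col_mx !add_col_mx addr0 subr0; congr col_mx.
  rewrite -addrA scalar_mxC -mulmxBl mulmxN mulmxA mulmxV // mul1mx subrr //.
have Zt' := eigenlist_ublock (dsubmx C') Zt (eigenlist_scalar 1 a).
by apply/(eigenlist_perm _ Zt'); rewrite perm_catC.
Qed.
End Eigenlist.

(** * Traces and idempotents *)

Section Trace.
Variable K : fieldType.

Lemma trace_exp_similar n m (A : 'M[K]_n) (B : 'M[K]_m) k :
  similar_mx A B -> \tr (A ^+ k) = \tr (B ^+ k).
Proof.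
move=> [P [Q [PQ QP PA]]]; have PAk : P *m A ^+ k = B ^+ k *m P.
  elim: k => [|k IH]; first by rewrite !expr0 mulmx1 mul1mx.
  by rewrite !exprS -!mulmxE mulmxA PA -mulmxA IH mulmxA.
by rewrite -[A ^+ k]mul1mx -QP -mulmxA PAk mxtrace_mulC -mulmxA PQ mulmx1.
Qed.

Lemma exp_ublock n m (A : 'M[K]_n) (C : 'M[K]_(n, m)) (D : 'M[K]_m) k :
  exists C', block_mx A C 0 D ^+ k = block_mx (A ^+ k) C' 0 (D ^+ k).
Proof.
elim: k => [|k [C' IH]]; first by exists 0; rewrite !expr0 -scalar_mx_block.
exists (A *m C' + C *m D ^+ k).
by rewrite !exprS IH -!mulmxE mulmx_block !mul0mx !mulmx0 addr0 !add0r.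
Qed.

(** By triangularization: the diagonal of a power of a block triangular
matrix consists of the powers of the diagonal blocks. *)
Lemma trace_exp n (A : 'M[K]_n) s k :
  eigenlist A s -> \tr (A ^+ k) = \sum_(a <- s) a ^+ k.
Proof.
elim: s n A => [|a s IH] n A As.
  have := eigenlist_size As; move=> /= n0; move: A As; rewrite n0 => A _.
  by rewrite [A ^+ k]thinmx0 mxtrace0 big_nil.
have [m [M [C [sAM Ms]]]] := eigenlist_peel As.
have [C' e] := exp_ublock M C (@scalar_mx K 1 a) k.
rewrite (trace_exp_similar _ sAM) e mxtrace_block (IH _ _ Ms) big_cons addrC.
by rewrite -(rmorphXn (@scalar_mx K 1)) mxtrace_scalar.
Qed.

Lemma trace_horner n (A : 'M[K]_n.+1) s p :
  eigenlist A s -> \tr (horner_mx A p) = \sum_(a <- s) p.[a].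
Proof.
move=> As; rewrite -{1}[p]coefK poly_def rmorph_sum raddf_sum /=.
under eq_bigr do rewrite /= linearZ rmorphXn /= horner_mx_X linearZ /= (trace_exp _ As).
under eq_bigr do rewrite mulr_sumr.
by rewrite exchange_big; apply: eq_bigr => a _; rewrite horner_coef.
Qed.

(** C is injective and R is surjective, so C (R C) R = E E = E = C R forces
R C = 1. *)
Lemma idempotent_factor n (E : 'M[K]_n) : E *m E = E ->
  exists (C : 'M[K]_(n, \rank E)) (R : 'M[K]_(\rank E, n)),
    C *m R = E /\ R *m C = 1%:M.
Proof.
move=> EE; exists (col_base E), (row_base E); split; first exact: mulmx_base.
apply: (row_full_inj (col_base_full E)); apply: (row_free_inj (row_base_free E)).
by rewrite /= mulmx1 mulmxA mulmx_base -mulmxA mulmx_base EE.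
Qed.

Lemma idempotent_trace n (E : 'M[K]_n) : E *m E = E -> \tr E = (\rank E)%:R.
Proof.
move=> /idempotent_factor[C [R [CR RC]]].
by rewrite -{1}CR mxtrace_mulC RC mxtrace1.
Qed.

(** Sylvester's determinant identity: both sides are the determinant of
[[1, X], [Y, 1]], by eliminating one or the other off-diagonal block. *)
Lemma det_1_sub_mul m n (X : 'M[K]_(m, n)) (Y : 'M[K]_(n, m)) :
  \det (1%:M - X *m Y) = \det (1%:M - Y *m X).
Proof.
have e : block_mx 1%:M 0 Y 1%:M *m block_mx 1%:M X 0 (1%:M - Y *m X) =
         block_mx (1%:M - X *m Y) X 0 1%:M *m block_mx 1%:M 0 Y 1%:M.
  rewrite !mulmx_block !mulmx0 !mul0mx !mulmx1 !mul1mx !addr0 !add0r subrK.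
  by rewrite (addrC _ (1%:M - _)) subrK.
move/(congr1 determinant): e; rewrite !det_mulmx !det_lblock !det_ublock !det1.
by rewrite !mulr1 !mul1r.
Qed.

(** The matrix G below is the resolvent of the idempotent E = C R at t, so
t - (E - F) = (t - E) (1 + G W Y), and both determinants reduce to the small
sizes e and f. *)
Lemma det_diff_idempotent n e f (C : 'M[K]_(n, e)) (R : 'M[K]_(e, n))
    (W : 'M[K]_(n, f)) (Y : 'M[K]_(f, n)) t :
  R *m C = 1%:M -> Y *m W = 1%:M -> t != 0 -> t - 1 != 0 ->
  \det (t%:M - (C *m R - W *m Y)) = t ^+ n * ((t - 1) / t) ^+ e
    * (t * (t - 1))^-1 ^+ f * \det ((t ^+ 2 - 1)%:M + Y *m (C *m R) *m W).
Proof.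
move=> RC YW t0 t1; set E := C *m R.
have EE : E *m E = E by rewrite /E mulmxA -(mulmxA C) RC mulmx1.
(* The coefficients solve (t - E) (x + y E) = 1, given E E = E. *)
pose G := t^-1%:M + (t * (t - 1))^-1 *: E.
have tG : (t%:M - E) *m G = 1%:M.
  rewrite mulmxBl !mulmxDr -scalar_mxM mulfV // mul_scalar_mx scalerA.
  rewrite mul_mx_scalar -scalemxAr EE -addrA -[RHS]addr0; congr (_ + _).
  rewrite -scalerDl -scalerBl (_ : _ - _ = 0) ?scale0r //.
  by field; rewrite t0 t1.
have detE : \det (t%:M - E) = t ^+ n * ((t - 1) / t) ^+ e.
  have -> : t%:M - E = t *: (1%:M - (t^-1 *: C) *m R).
    by rewrite scalerBr -scalemxAl scalerA mulfV // scale1r scalemx1.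
  rewrite detZ det_1_sub_mul -scalemxAr RC scalemx1 -raddfB /= det_scalar.
  by congr (_ * _ ^+ _); field.
have -> : t%:M - (E - W *m Y) = (t%:M - E) *m (1%:M - (- (G *m W)) *m Y).
  by rewrite mulNmx opprK mulmxDr mulmx1 !mulmxA tG mul1mx opprB addrA addrAC.
rewrite det_mulmx detE det_1_sub_mul mulmxN opprK -!mulrA; do 2!congr (_ * _).
rewrite -detZ; congr (\det _).
have -> : Y *m (G *m W) = t^-1%:M + (t * (t - 1))^-1 *: (Y *m E *m W).
  rewrite mulmxDl mulmxDr mul_scalar_mx -scalemxAl -!scalemxAr YW mulmxA.
  by rewrite scalemx1.
rewrite scalerDr scale_scalar_mx addrA -raddfD /=; congr (_%:M + _).
by field; rewrite t0 t1.
Qed.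

(** The determinant of size f in [det_diff_idempotent] is even in t; the
explicit factors alone distinguish t from - t. *)
Lemma det_diff_idempotent_sym n (E F : 'M[K]_n) r (t : K) :
  E *m E = E -> F *m F = F -> \rank E = (\rank F + r)%N ->
  t != 0 -> t - 1 != 0 -> t + 1 != 0 ->
  \det (t%:M - (E - F)) * (t + 1) ^+ r =
  (-1) ^+ n * \det ((- t)%:M - (E - F)) * (t - 1) ^+ r.
Proof.
move=> EE FF er t0 t1 t2.
have [C [R [CR RC]]] := idempotent_factor EE.
have [W [Y [WY YW]]] := idempotent_factor FF.
have t2' : - t - 1 != 0 by rewrite -opprD oppr_eq0.
have := det_diff_idempotent RC YW t0 t1; rewrite CR WY => ->.
have := @det_diff_idempotent _ _ _ _ _ _ _ (- t) RC YW _ t2'.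
rewrite oppr_eq0 CR WY sqrrN => -> //.
rewrite (exprNn t n).
have -> : (- t - 1) / - t = (t + 1) / t by rewrite -opprD invrN mulrNN.
have -> : - t * (- t - 1) = t * (t + 1) by ring.
set D := \det _; rewrite er !exprVn !exprMn !exprVn !exprD.
have sgn : (-1) ^+ n * (-1) ^+ n = 1 :> K by rewrite -expr2 sqrr_sign.
have nz (x : K) (k : nat) : x != 0 -> x ^+ k != 0 by exact: expf_neq0.
move: (nz _ (\rank F) t0) (nz _ (\rank F) t1) (nz _ (\rank F) t2) (nz _ r t0).
set tf := t ^+ \rank F; set uf := (t - 1) ^+ \rank F.
set vf := (t + 1) ^+ \rank F; set tr := t ^+ r => h1 h2 h3 h4.
rewrite !mulrA sgn mul1r.
by field; rewrite h1 h2 h3 h4.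
Qed.

(** E - F - 1 = (E - 1) - F and E - 1 has rank n - \rank E. *)
Lemma rank_diff_idempotent n (E F : 'M[K]_n) : E *m E = E ->
  (\rank (E - F - 1%:M)%R + \rank E <= n + \rank F)%N.
Proof.
move=> EE; have rE : (\rank (E - 1%:M)%R + \rank E <= n)%N.
  by apply: mulmx0_rank_max; rewrite mulmxBl EE mul1mx subrr.
rewrite addrAC (leq_trans _ (leq_add rE (leqnn _))) // addnAC leq_add2r.
by rewrite -(mxrank_opp F) mxrank_add.
Qed.
End Trace.

(** * Complex-valued integrals over a period *)

Section ComplexIntegral.
Variable R : realType.
Implicit Types (g h : R -> R[i]) (c : R[i]).
Local Notation Re := complex.Re.
Local Notation Im := complex.Im.
Local Notation normc := Normc.normc.

(** Continuity is stated on the components because integrals are taken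
componentwise. *)
Definition ccont g := continuous (fun t => Re (g t) : R^o) /\
  continuous (fun t => Im (g t) : R^o).

Lemma ccont_cst c : ccont (fun=> c).
Proof. by split=> t; apply: cvg_cst. Qed.

Lemma ReD (x y : R[i]) : Re (x + y) = Re x + Re y.
Proof. by case: x; case: y. Qed.
Lemma ImD (x y : R[i]) : Im (x + y) = Im x + Im y.
Proof. by case: x; case: y. Qed.
Lemma ReM (x y : R[i]) : Re (x * y) = Re x * Re y - Im x * Im y.
Proof. by case: x; case: y. Qed.
Lemma ImM (x y : R[i]) : Im (x * y) = Re x * Im y + Im x * Re y.
Proof. by case: x; case: y. Qed.

Lemma ccontD g h : ccont g -> ccont h -> ccont (fun t => g t + h t).
Proof.
move=> [g1 g2] [h1 h2]; split=> t.
  by under eq_fun do rewrite ReD; apply: cvgD; [exact: g1|exact: h1].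
by under eq_fun do rewrite ImD; apply: cvgD; [exact: g2|exact: h2].
Qed.

Lemma ccontM g h : ccont g -> ccont h -> ccont (fun t => g t * h t).
Proof.
move=> [g1 g2] [h1 h2]; split=> t.
  under eq_fun do rewrite ReM; apply: cvgB; apply: cvgM;
  [exact: g1|exact: h1|exact: g2|exact: h2].
under eq_fun do rewrite ImM; apply: cvgD; apply: cvgM;
[exact: g1|exact: h2|exact: g2|exact: h1].
Qed.

Lemma ccontX g k : ccont g -> ccont (fun t => g t ^+ k).
Proof.
move=> gc; elim: k => [|k IH]; first exact: ccont_cst.
by under eq_fun do rewrite exprS; apply: ccontM.
Qed.

Lemma ccontV g : (forall t, g t != 0) -> ccont g -> ccont (fun t => (g t)^-1).
Proof.
move=> g0 [g1 g2]; pose q t := (Re (g t) ^+ 2 + Im (g t) ^+ 2)^-1 : R^o.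
have qc : continuous q.
  move=> t; apply: cvgV.
    have := g0 t; rewrite eq_complex /= negb_and => nz.
    by rewrite paddr_eq0 ?sqr_ge0 // !sqrf_eq0 negb_and.
  by apply: cvgD; apply: cvgM; [exact: g1|exact: g1|exact: g2|exact: g2].
split=> t.
  have -> : (fun t => Re (g t)^-1) = (fun t => Re (g t) * q t).
    by apply/funext=> u; rewrite /q; case: (g u).
  by apply: cvgM; [exact: g1|exact: qc].
have -> : (fun t => Im (g t)^-1) = (fun t => - (Im (g t) * q t)).
  by apply/funext=> u; rewrite /q; case: (g u).
by apply: cvgN; apply: cvgM; [exact: g2|exact: qc].
Qed.

Lemma ccont_sum (I : Type) (r : seq I) (P : pred I) (F : I -> R -> R[i]) :
  (forall i, ccont (F i)) -> ccont (fun t => \sum_(i <- r | P i) F i t).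
Proof.
move=> Fc; elim: r => [|i r IH].
  by under eq_fun do rewrite big_nil; apply: ccont_cst.
under eq_fun do rewrite big_cons.
by case: (P i) => //; apply: ccontD.
Qed.

Lemma ccont_cis : ccont (@cis R).
Proof. by split=> t; [exact: continuous_cos|exact: continuous_sin]. Qed.

Definition cint g := cintegral 0 (2 * pi) g.

Lemma continuous_integrable (f : R -> R^o) : continuous f ->
  (@lebesgue_measure R).-integrable `[0, 2 * pi] (EFin \o f).
Proof.
move=> fc; apply: continuous_compact_integrable; first exact: segment_compact.
by apply: continuous_subspaceT.
Qed.

Lemma cintD g h : ccont g -> ccont h -> cint (fun t => g t + h t) = cint g + cint h.
Proof.
move=> [g1 g2] [h1 h2]; apply/eqP; rewrite eq_complex /=.
under eq_Rintegral do rewrite ReD.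
under [X in _ && (X == _)]eq_Rintegral do rewrite ImD.
by rewrite !RintegralD ?eqxx //; apply: continuous_integrable.
Qed.

Lemma cintZ c g : ccont g -> cint (fun t => c * g t) = c * cint g.
Proof.
move=> [g1 g2]; apply/eqP; rewrite eq_complex.
rewrite ReM ImM /=.
under eq_Rintegral do rewrite ReM.
under [X in _ && (X == _)]eq_Rintegral do rewrite ImM.
have cz (a : R) (f : R -> R^o) : continuous f -> continuous (fun t => a * f t : R^o).
  by move=> fc t; apply: cvgM; [exact: cvg_cst|exact: fc].
rewrite RintegralB ?RintegralD ?RintegralZl ?eqxx //;
  by apply: continuous_integrable => //; apply: cz.
Qed.

Lemma cint_sum (I : Type) (r : seq I) (P : pred I) (F : I -> R -> R[i]) :
  (forall i, ccont (F i)) ->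
  cint (fun t => \sum_(i <- r | P i) F i t) = \sum_(i <- r | P i) cint (F i).
Proof.
move=> Fc; elim: r => [|i r IH].
  rewrite big_nil -[RHS](mul0r (cint (fun=> 1))) -cintZ; last exact: ccont_cst.
  by congr cint; apply/funext=> t; rewrite big_nil mul0r.
have -> : (fun t => \sum_(j <- i :: r | P j) F j t) =
   (fun t => (if P i then F i t else 0) + \sum_(j <- r | P j) F j t).
  by apply/funext=> t; rewrite big_cons; case: (P i); rewrite ?add0r.
rewrite cintD; last 2 first.
- by case: (P i) => //; apply: ccont_cst.
- exact: ccont_sum.
rewrite IH big_cons; case: (P i) => //.
rewrite -[RHS]add0r; congr (_ + _).
rewrite -[RHS](mul0r (cint (fun=> 1))) -cintZ; last exact: ccont_cst.
by congr cint; apply/funext=> t; rewrite mul0r.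
Qed.

Lemma cint1 : cint (fun=> 1) = (2 * pi)%:C.
Proof.
rewrite /cint /cintegral /= !Rintegral_cst //= lebesgue_measure_itv /=.
rewrite lte_fin mulr_gt0 ?pi_gt0 //=.
by rewrite subr0 mul1r mul0r.
Qed.

Lemma cisD (s t : R) : cis (s + t) = cis s * cis t.
Proof.
apply/eqP; rewrite eq_complex ReM ImM /= cosD sinD addrC eqxx.
by rewrite (addrC (sin s * _)) eqxx.
Qed.

Lemma cis0 : cis 0 = 1 :> R[i].
Proof. by rewrite /cis cos0 sin0. Qed.

Lemma cisX (t : R) k : cis t ^+ k = cis (k%:R * t).
Proof.
elim: k => [|k IH]; first by rewrite expr0 mul0r cis0.
by rewrite exprS IH -cisD mulrSr mulrDl mul1r addrC.
Qed.

Lemma cisN (t : R) : cis (- t) = (cis t)^-1.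
Proof.
have e : cis t * cis (- t) = 1 by rewrite -cisD subrr cis0.
have z : cis t != 0 by apply: contra_eq_neq e => ->; rewrite mul0r eq_sym oner_neq0.
by apply: (mulfI z); rewrite e mulfV.
Qed.

Lemma cis2pi k : cis (k%:R * (2 * pi)) = 1 :> R[i].
Proof.
rewrite -cisX (_ : cis _ = 1) ?expr1n //.
by rewrite /cis mulr_natl cos2pi sin2pi.
Qed.

(** The primitives sin (a t) / a and - cos (a t) / a take equal values at
both ends of the interval. *)
Lemma cint_cisZ (a : R) : a != 0 -> cis (a * (2 * pi)) = 1 ->
  cint (fun t => cis (a * t)) = 0.
Proof.
move=> a0 [c1 s0].
have p2 : 0 < 2 * pi :> R by rewrite mulr_gt0 ?pi_gt0.
have key (F f : R -> R^o) : (forall t, is_derive t (1 : R) F (f t)) -> continuous f ->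
    F (2 * pi) = F 0 -> Rintegral (@lebesgue_measure R) `[0, 2 * pi] f = 0.
  move=> dF fc FF; rewrite /Rintegral (@continuous_FTC2 _ f F) //.
  - by rewrite FF -EFinB subrr.
  - by apply: continuous_subspaceT.
  - have Fc : continuous F.
      by move=> t; apply: differentiable_continuous; apply/derivable1_diffP;
         case: (dF t).
    split; first by move=> t _; case: (dF t).
      by apply: cvg_at_right_filter; apply: Fc.
    by apply: cvg_at_left_filter; apply: Fc.
  by move=> t _; rewrite derive1E; case: (dF t).
rewrite /cint /cintegral /=; congr (_ +i* _).
  apply: (key (fun t => a^-1 * sin (a * t))).
  - move=> t; apply: is_derive_eq.
    by rewrite /GRing.scale /= ; field.
  - move=> t; apply: continuous_comp; last exact: continuous_cos.
    by apply: cvgM; [exact: cvg_cst|exact: cvg_id].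
  - by rewrite s0 !mulr0 sin0 mulr0.
apply: (key (fun t => - a^-1 * cos (a * t))).
- move=> t; apply: is_derive_eq.
  by rewrite /GRing.scale /= ; field.
- move=> t; apply: continuous_comp; last exact: continuous_sin.
  by apply: cvgM; [exact: cvg_cst|exact: cvg_id].
- by rewrite c1 mulr0 cos0.
Qed.

End ComplexIntegral.

(** * Integrals of poles over circles *)

Section CircleIntegral.
Variable R : realType.
Implicit Types (g h : R -> R[i]) (c : R[i]).
Local Notation normc := Normc.normc.

Lemma normc_ge0 (z : R[i]) : 0 <= normc z.
Proof. by case: z => x y; apply: sqrtr_ge0. Qed.

Lemma normc_gt0 (z : R[i]) : (0 < normc z) = (z != 0).
Proof.
rewrite lt_def normc_ge0 andbT; congr (~~ _); apply/eqP/eqP=> [|->].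
  exact: Normc.eq0_normc.
exact: Normc.normc0.
Qed.

Lemma normc_distl (x y : R[i]) : normc x - normc y <= normc (x - y).
Proof. by rewrite lerBlDr (le_trans _ (le_normcD _ _)) // subrK. Qed.

Lemma normcX (z : R[i]) k : normc (z ^+ k) = normc z ^+ k.
Proof.
by elim: k => [|k IH]; rewrite ?Normc.normc1 // !exprS Normc.normcM IH.
Qed.

Lemma normcR (x : R) : normc x%:C = `|x|.
Proof. by rewrite /= expr0n /= addr0 sqrtr_sqr. Qed.

Lemma normc_cis (t : R) : normc (cis t) = 1.
Proof. by rewrite /= cos2Dsin2 sqrtr1. Qed.

Lemma normc_geRe (z : R[i]) : `|complex.Re z| <= normc z.
Proof. by case: z => x y /=; rewrite -sqrtr_sqr ler_wsqrtr // lerDl sqr_ge0. Qed.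

Lemma normc_geIm (z : R[i]) : `|complex.Im z| <= normc z.
Proof. by case: z => x y /=; rewrite -sqrtr_sqr ler_wsqrtr // lerDr sqr_ge0. Qed.

Lemma normc_le_ReIm (x y : R) : normc (x +i* y) <= `|x| + `|y|.
Proof.
rewrite /= -[leRHS]ger0_norm ?addr_ge0 // -sqrtr_sqr ler_wsqrtr //.
rewrite sqrrD -!normrX !(ger0_norm (sqr_ge0 _)) lerD2r lerDl.
by rewrite mulrn_wge0 // mulr_ge0.
Qed.

Lemma cis_neq0 (t : R) : cis t != 0.
Proof. by rewrite -normc_gt0 normc_cis. Qed.

Lemma normc_cint g M : ccont g -> (forall t, normc (g t) <= M) ->
  normc (cint g) <= (M * (2 * pi)) *+ 2.
Proof.
move=> [g1 g2] gM; rewrite /cint /cintegral.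
have bound (f : R -> R^o) : continuous f -> (forall t, `|f t| <= M) ->
    `|Rintegral (@lebesgue_measure R) `[0, 2 * pi] f| <= M * (2 * pi).
  move=> fc fM; apply: le_trans (le_normr_Rintegral _ _) _ => //.
    exact: continuous_integrable.
  have p2 : 0 < 2 * pi :> R by rewrite mulr_gt0 ?pi_gt0.
  have -> : M * (2 * pi) = Rintegral (@lebesgue_measure R) `[0, 2 * pi] (fun=> M).
    rewrite Rintegral_cst //= lebesgue_measure_itv /= lte_fin p2 /= subr0 //.
  apply: le_Rintegral => //.
    apply: continuous_integrable => t; apply: cvg_norm; exact: fc.
  by apply: continuous_integrable => t; apply: cvg_cst.
apply: le_trans (normc_le_ReIm _ _) _; rewrite mulr2n lerD //; apply: bound => // t.
  exact: le_trans (normc_geRe _) (gM t).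
exact: le_trans (normc_geIm _) (gM t).
Qed.

Lemma geometric_squeeze (v x B : R) : 0 <= x < 1 ->
  (forall N : nat, v <= x ^+ N * B) -> v <= 0.
Proof.
move=> /andP[x0 x1] h; have := @cvg_expr R x; rewrite ger0_norm // => /(_ x1) c.
have : (x ^+ N * B) @[N --> \oo] --> (0 * B : R^o) by apply: cvgMr_tmp.
rewrite mul0r => cB.
rewrite leNgt; apply/negP => v0; near \oo => N.
suff : x ^+ N * B < v by rewrite ltNge h.
by near: N; apply: (cvgr_lt (0 : R^o)).
Unshelve. all: by end_near. Qed.

(** The vanishing of the integral of z^(j-1) (z - c)^-k over a circle that
does not enclose c, without primitives.  Writing c = rho w - (rho w - c)
relates the integral I_j for the exponent k + 1 to I_(j+1) and to an integral
for the exponent k, which vanishes by induction.  So I_j = (rho / c)^N I_(j+N)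
for every N, and the integrals I_(j+N) are bounded independently of N. *)
Lemma cint_off (rho : R) c k j : 0 < rho -> rho < normc c -> (0 < j)%N ->
  cint (fun t => cis t ^+ j * (rho%:C * cis t - c)^-1 ^+ k) = 0.
Proof.
move=> rho0 rhoc; set d := fun t : R => rho%:C * cis t - c.
have nd t : normc c - rho <= normc (d t).
  rewrite /d -[leRHS]normcN opprB (le_trans _ (normc_distl _ _)) //.
  by rewrite Normc.normcM normc_cis mulr1 normcR gtr0_norm.
have d0 t : d t != 0 by rewrite -normc_gt0 (lt_le_trans _ (nd t)) // subr_gt0.
have dc : ccont (fun t => (d t)^-1).
  apply: ccontV => //; apply: ccontD; last exact: ccont_cst.
  by apply: ccontM; [exact: ccont_cst|exact: ccont_cis].
have fc i l : ccont (fun t => cis t ^+ i * (d t)^-1 ^+ l).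
  by apply: ccontM; apply: ccontX => //; apply: ccont_cis.
have c0 : c != 0 by rewrite -normc_gt0 (lt_trans rho0).
elim: k j => [|k IH] j j0.
  have -> : (fun t => cis t ^+ j * (d t)^-1 ^+ 0) = (fun t => cis (j%:R * t)).
    by apply/funext=> t; rewrite expr0 mulr1 cisX.
  by apply: cint_cisZ; rewrite ?cis2pi // pnatr_eq0 -lt0n.
pose I i := cint (fun t => cis t ^+ i * (d t)^-1 ^+ k.+1).
(* The identity c / d = (rho w - d) / d under the integral sign. *)
have step i : (0 < i)%N -> I i = (rho%:C / c) * I i.+1.
  move=> i0; apply: (mulfI c0); rewrite mulrA mulrCA mulfV // mulr1.
  rewrite -cintZ // -cintZ // -[RHS]subr0 -(IH i i0) -[X in _ - X]mul1r -mulNr.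
  rewrite -cintZ // -cintD; last 2 first.
  - by apply: ccontM => //; apply: ccont_cst.
  - by apply: ccontM => //; apply: ccont_cst.
  congr cint; apply/funext=> t; rewrite !exprS.
  set u := (d t)^-1 ^+ k; set w := cis t ^+ i.
  have -> : c = rho%:C * cis t - d t by rewrite /d opprB addrC subrK.
  by field; rewrite d0.
have iter N i : (0 < i)%N -> I i = (rho%:C / c) ^+ N * I (i + N)%N.
  elim: N i => [|N IHN] i i0; first by rewrite expr0 mul1r addn0.
  by rewrite (IHN _ i0) (step (i + N)%N) ?addn_gt0 ?i0 // mulrA -exprSr addnS.
pose M := (normc c - rho)^-1 ^+ k.+1.
have Ib i : normc (I i) <= (M * (2 * pi)) *+ 2.
  apply: normc_cint => // t; rewrite Normc.normcM !normcX normc_cis expr1n mul1r.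
  by rewrite Normc.normcV lerXn2r ?nnegrE ?invr_ge0 ?normc_ge0 ?subr_ge0 ?(ltW rhoc) //
     lef_pV2 ?posrE ?subr_gt0 // normc_gt0.
apply/eqP; rewrite -[_ == 0]negbK -normc_gt0 -leNgt.
apply: (@geometric_squeeze _ (rho / normc c) ((M * (2 * pi)) *+ 2)).
  by rewrite divr_ge0 ?normc_ge0 ?(ltW rho0) //= ltr_pdivrMr ?mul1r ?normc_gt0.
move=> N; rewrite -/(I j) (iter N j j0) Normc.normcM normcX Normc.normcM Normc.normcV.
rewrite normcR gtr0_norm // ler_wpM2l // exprn_ge0 // divr_ge0 ?normc_ge0 //.
exact: ltW.
Qed.

Definition circle_form (f : R[i] -> R[i]) a rho t :=
  f (circle a rho t) * ('i%C * rho%:C * cis t).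

Lemma ccont_circle_form a (rho : R) (lam : R[i]) k : 0 < rho ->
  lam = a \/ rho < normc (lam - a) ->
  ccont (circle_form (fun z => (z - lam)^-1 ^+ k) a rho).
Proof.
move=> rho0 sep; apply: ccontM; last first.
  by apply: ccontM; [exact: ccont_cst|exact: ccont_cis].
apply: ccontX; apply: ccontV => [t|]; last first.
  apply: ccontD; last exact: ccont_cst.
  apply: ccontD; first exact: ccont_cst.
  by apply: ccontM; [exact: ccont_cst|exact: ccont_cis].
rewrite /circle; case: sep => [->|sep].
  rewrite addrC addrA addNr add0r mulf_neq0 ?cis_neq0 //.
  by rewrite -normc_gt0 normcR normr_gt0 gt_eqF.
rewrite addrAC -[a - lam]opprB addrC subr_eq0; apply: contraTneq sep => <-.
by rewrite Normc.normcM normcR normc_cis mulr1 gtr0_norm // ltxx.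
Qed.

(** Around its own centre the pole reduces to a power of cis; the other
poles lie outside the circle and [cint_off] applies. *)
Lemma circle_integral_pole a (rho : R) (lam : R[i]) k : 0 < rho ->
  lam = a \/ rho < normc (lam - a) ->
  circle_integral (fun z => (z - lam)^-1 ^+ k.+1) a rho =
  if (lam == a) && (k == 0)%N then 2 * pi%:C * 'i%C else 0.
Proof.
move=> rho0 sep; rewrite /circle_integral -/(cint _).
have rC0 : rho%:C != 0 :> R[i] by rewrite -normc_gt0 normcR normr_gt0 gt_eqF.
case: (eqVneq lam a) => [la|la] /=.
  have -> : (fun t => (circle a rho t - lam)^-1 ^+ k.+1 * ('i%C * rho%:C * cis t)) =
      (fun t => ('i%C * rho%:C ^- k) * cis (- k%:R * t)).
    apply/funext=> t; rewrite /circle la addrAC subrr add0r.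
    rewrite mulNr cisN -cisX exprVn exprMn exprSr [cis t ^+ k.+1]exprSr.
    have rk : rho%:C ^+ k != 0 :> R[i] by rewrite expf_neq0.
    have ck : cis t ^+ k != 0 by rewrite expf_neq0 ?cis_neq0.
    have c1 := cis_neq0 t.
    by field; rewrite rC0 rk ck c1.
  have cc (b : R) : ccont (fun t => cis (b * t)).
    split=> t; apply: continuous_comp.
    - by apply: cvgM; [exact: cvg_cst|exact: cvg_id].
    - exact: continuous_cos.
    - by apply: cvgM; [exact: cvg_cst|exact: cvg_id].
    - exact: continuous_sin.
  rewrite cintZ //; case: eqVneq => [->|k0].
    have -> : (fun t => cis (- 0%:R * t)) = (fun=> 1 : R[i]).
      by apply/funext=> t; rewrite oppr0 mul0r cis0.
    by rewrite cint1 rmorphM /= expr0 invr1 mulr1 mulrC rmorph_nat.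
  rewrite cint_cisZ ?mulr0 // ?oppr_eq0 ?pnatr_eq0 // mulNr cisN cis2pi invr1 //.
case: sep => [la'|sep]; first by rewrite la' eqxx in la.
have -> : (fun t => (circle a rho t - lam)^-1 ^+ k.+1 * ('i%C * rho%:C * cis t)) =
    (fun t => ('i%C * rho%:C) * (cis t ^+ 1 * (rho%:C * cis t - (lam - a))^-1 ^+ k.+1)).
  apply/funext=> t; rewrite /circle.
  have -> : a + rho%:C * cis t - lam = rho%:C * cis t - (lam - a).
    by ring.
  by rewrite expr1; ring.
rewrite cintZ ?cint_off ?mulr0 //.
apply: ccontM; first exact/ccontX/ccont_cis.
apply: ccontX; apply: ccontV => [t|]; last first.
  apply: ccontD; last exact: ccont_cst.
  by apply: ccontM; [exact: ccont_cst|exact: ccont_cis].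
rewrite subr_eq0; apply: contraTneq sep => <-.
by rewrite Normc.normcM normcR normc_cis mulr1 gtr0_norm // ltxx.
Qed.
End CircleIntegral.

(** * Polynomials that isolate an eigenvalue *)

Section Coprime.
Variable K : fieldType.

Lemma coprimep_XsubC_exp (a b : K) i j : a != b ->
  coprimep (('X - a%:P) ^+ i) (('X - b%:P) ^+ j).
Proof.
by move=> ab; rewrite coprimep_expl // coprimep_expr // coprimep_XsubC2 // subr_eq0 eq_sym.
Qed.

Lemma coprimep_prod_exp (a : K) k (u : seq K) (P : pred K) :
  (forall b, b \in u -> P b -> a != b) ->
  coprimep (('X - a%:P) ^+ k) (\prod_(b <- u | P b) ('X - b%:P) ^+ k).
Proof.
move=> h; rewrite big_seq_cond; elim/big_rec: _ => [|b p /andP[bu Pb] cp].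
  exact: coprimep1.
by rewrite coprimepMr cp andbT coprimep_XsubC_exp // h.
Qed.

Lemma dvdp_prod_coprime (u : seq K) k g : uniq u ->
  (forall a, a \in u -> ('X - a%:P) ^+ k %| g) ->
  \prod_(a <- u) ('X - a%:P) ^+ k %| g.
Proof.
elim: u => [|a u IH] /=; first by rewrite big_nil dvd1p.
move=> /andP[au uu] h; rewrite big_cons Gauss_dvdp.
  by rewrite h ?mem_head // IH // => b bu; rewrite h // inE bu orbT.
by apply: coprimep_prod_exp => b bu _; apply: contraNneq au => ->.
Qed.

(** Chinese remainder theorem, through a Bezout relation between (X - a)^k and
the product Q of the other factors. *)
Lemma spectral_poly (u : seq K) k a : exists p : {poly K},
  ('X - a%:P) ^+ k %| p - 1 /\
  (forall b, b \in u -> b != a -> ('X - b%:P) ^+ k %| p).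
Proof.
set Q := \prod_(b <- u | b != a) ('X - b%:P) ^+ k.
have /Bezout_eq1_coprimepP[[v w] /= e] : coprimep (('X - a%:P) ^+ k) Q.
  by apply: coprimep_prod_exp => b _; rewrite eq_sym.
exists (w * Q); split.
  by rewrite -e opprD addrCA subrr addr0 dvdpNr dvdp_mull.
move=> b bu ba; apply: dvdp_mull; rewrite /Q (big_rem b) //= ba.
exact: dvdp_mulr.
Qed.

(** Cayley-Hamilton: the characteristic polynomial divides the product of
the (X - a)^N over the distinct eigenvalues a, N being the size. *)
Lemma horner_mx_eq0 n (A : 'M[K]_n.+1) s g : eigenlist A s ->
  (forall a, a \in s -> ('X - a%:P) ^+ size s %| g) -> horner_mx A g = 0.
Proof.
move=> As h; have : char_poly A %| g.
  apply: dvdp_trans (dvdp_prod_coprime (undup_uniq s) _); last first.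
    by move=> a; rewrite mem_undup; apply: h.
  rewrite As -prodr_undup_exp_count.
  apply: (big_ind2 (fun x y : {poly K} => x %| y)) => //.
    by move=> *; apply: dvdp_mul.
  by move=> a _; apply: dvdp_exp2l; apply: count_size.
by move=> /dvdpP[q ->]; rewrite rmorphM /= Cayley_Hamilton mulr0.
Qed.
End Coprime.

Section SpectralProjections.
Variables (K : numFieldType) (n : nat) (A : 'M[K]_n.+1) (s : seq K).
Hypothesis As : eigenlist A s.
Let u := undup s.
Let N := size s.
Variable p : K -> {poly K}.
Hypothesis p1 : forall a, ('X - a%:P) ^+ N %| p a - 1.
Hypothesis p0 : forall a b, b \in u -> b != a -> ('X - b%:P) ^+ N %| p a.

Let pD (D : pred K) := \sum_(a <- u | D a) p a.

Lemma spectral_sum_mod D b : b \in u -> ('X - b%:P) ^+ N %| pD D - (D b)%:R.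
Proof.
move=> bu; have -> : (D b)%:R = \sum_(a <- u | D a) (a == b)%:R :> {poly K}.
  rewrite big_mkcond (bigD1_seq b) ?undup_uniq //= eqxx big1 ?addr0 => [|a /negPf->].
    by case: (D b).
  by case: (D a).
rewrite -sumrB; apply: (big_ind (fun q => _ %| q)) => [|x y|a _];
  [exact: dvdp0|exact: dvdp_add|].
by case: eqVneq => [->|ab]; rewrite ?p1 // subr0 p0 // eq_sym.
Qed.

Lemma spectral_idempotent D :
  horner_mx A (pD D) *m horner_mx A (pD D) = horner_mx A (pD D).
Proof.
apply/eqP; rewrite -subr_eq0 mulmxE -rmorphM -rmorphB /=; apply/eqP.
apply: (horner_mx_eq0 As) => a; rewrite -mem_undup => au.
have := spectral_sum_mod D au; case: (D a) => /=.
  have -> : pD D * pD D - pD D = pD D * (pD D - 1) by rewrite mulrBr mulr1.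
  exact: dvdp_mull.
have -> : pD D * pD D - pD D = (pD D - 1) * pD D by rewrite mulrBl mul1r.
by rewrite subr0; apply: dvdp_mull.
Qed.

(** The rank of an idempotent is its trace, and the trace of a polynomial in A
is the sum of its values at the eigenvalues; here these values are 0 or 1. *)
Lemma spectral_rank D : \rank (horner_mx A (pD D)) = count D s.
Proof.
apply/eqP; rewrite -(eqr_nat K) -idempotent_trace ?spectral_idempotent //.
rewrite (trace_horner _ As) -sum1_count natr_sum [X in _ == X]big_mkcond /=.
apply/eqP; rewrite big_seq [RHS]big_seq; apply: eq_bigr => a a_s.
have N0 : (0 < N)%N by rewrite /N; case: (s) a_s.
have au : a \in u by rewrite mem_undup.
have /(dvdp_trans (dvdp_exp N0 (dvdpp _))) := spectral_sum_mod D au.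
rewrite dvdp_XsubCl rootE hornerD hornerN -[_%:R]polyC_natr hornerC subr_eq0.
by move/eqP->; case: (D a).
Qed.

(** Partial fractions of the resolvent.  On the part of a, the geometric sum
of (A - a)^k / (z - a)^(k+1) inverts z - A = (z - a) - (A - a) because A - a
is nilpotent there. *)
Lemma spectral_resolvent z : z \notin s ->
  invmx (z%:M - A) = \sum_(a <- u) \sum_(k < N)
    (z - a)^-1 ^+ k.+1 *: horner_mx A (('X - a%:P) ^+ k * p a).
Proof.
move=> zs; pose g := \sum_(a <- u) \sum_(k < N)
    ((z - a)^-1 ^+ k.+1) *: (('X - a%:P) ^+ k * p a).
have -> : \sum_(a <- u) \sum_(k < N)
    (z - a)^-1 ^+ k.+1 *: horner_mx A (('X - a%:P) ^+ k * p a) = horner_mx A g.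
  rewrite rmorph_sum /=; apply: eq_bigr => a _.
  by rewrite rmorph_sum; apply: eq_bigr => k _; rewrite /= linearZ.
suff e : (z%:M - A) *m horner_mx A g = 1%:M.
  have [zu _] := mulmx1_unit e.
  by rewrite -[RHS](mulKmx zu) e mulmx1.
have -> : z%:M - A = horner_mx A (z%:P - 'X).
  by rewrite rmorphB /= horner_mx_C horner_mx_X.
rewrite mulmxE -rmorphM /=; apply/eqP.
rewrite -subr_eq0 -[1%:M](rmorph1 (horner_mx A)) -rmorphB /=; apply/eqP.
have -> : (z%:P - 'X) * g = pD predT -
     \sum_(a <- u) (z - a)^-1 ^+ N *: (('X - a%:P) ^+ N * p a).
  rewrite /g mulr_sumr -sumrB [LHS]big_seq [RHS]big_seq; apply: eq_bigr => a.
  rewrite mem_undup => a_s.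
  have za : z - a != 0 by rewrite subr_eq0; apply: contraNneq zs => ->.
  elim: (N) => [|m IH]; first by rewrite big_ord0 mulr0 !expr0 mul1r scale1r subrr.
  rewrite big_ord_recr /= mulrDr IH -addrA; congr (_ + _).
  have -> : z%:P - 'X = (z - a)%:P - ('X - a%:P) by rewrite polyCB; ring.
  rewrite mulrBl !mul_polyC scalerA -scalerAr mulrA -exprS [(z - a)^-1 ^+ m.+1]exprS.
  by rewrite mulrA mulfV // mul1r addrA addNr add0r.
apply: (horner_mx_eq0 As) => b; rewrite -mem_undup => bu.
rewrite addrAC dvdp_sub ?(spectral_sum_mod predT bu) //.
rewrite big_seq; apply: (big_ind (fun q => _ %| q)) => [|x y|a au];
  [exact: dvdp0|exact: dvdp_add|].
rewrite -mul_polyC dvdp_mull //; case: (eqVneq b a) => [->|ba]; first exact: dvdp_mulr.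
by apply: dvdp_mull; apply: p0.
Qed.
End SpectralProjections.

(** * Ranks of Riesz idempotents *)

Section RieszDimension.
Variable R : realType.
Local Notation C := R[i].
Local Notation normc := Normc.normc.

Lemma spectrumE n (A : 'M[C]_n) s : eigenlist A s -> spectrum A = [set` s].
Proof.
move=> As; apply/seteqP; split=> a; rewrite /spectrum /= (eigenlist_unit _ As) negbK //.
Qed.

Lemma pos_lower_bound (l : seq R) : (forall x, x \in l -> 0 < x) ->
  exists2 rho : R, 0 < rho & forall x, x \in l -> rho < x.
Proof.
elim: l => [|y l IH] h; first by exists 1.
have [|rho rho0 H] := IH; first by move=> x xl; apply: h; rewrite inE xl orbT.
have y0 : 0 < y by apply: h; rewrite mem_head.
exists (Num.min rho (y / 2)); first by rewrite lt_min rho0 divr_gt0.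
move=> x; rewrite inE => /predU1P[->|/H xr]; rewrite gt_min ?xr //.
by rewrite ltr_pdivrMr // mulr_natr mulr2n ltrDl y0 orbT.
Qed.

Lemma riesz_radiusP n (A : 'M[C]_n) s : eigenlist A s ->
  separating_radius A (riesz_radius A).
Proof.
move=> As; apply: xgetPex; rewrite /separating_radius (spectrumE As) /=.
pose l := [seq normc (a - b) / 2 | a <- s, b <- [seq b <- s | b != a]].
have [|rho rho0 H] := @pos_lower_bound l.
  move=> x /allpairsPdep[a [b [_]]]; rewrite mem_filter => /andP[ba _] ->.
  by rewrite divr_gt0 // normc_gt0 subr_eq0 eq_sym.
exists rho; split=> // a b a_s b_s /eqP ab.
rewrite -mulr2n -mulr_natr -ltr_pdivlMr // H //.
by apply/allpairsPdep; exists a, b; rewrite mem_filter b_s eq_sym ab.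
Qed.

(** Of all the poles only the simple one at the centre contributes. *)
Lemma circle_integral_resolvent (u : seq C) N (c : C -> 'I_N.+1 -> C) f a (rho : R) :
  uniq u -> a \in u -> 0 < rho ->
  (forall b, b \in u -> b != a -> rho < normc (b - a)) ->
  (forall t, f (circle a rho t) = \sum_(b <- u) \sum_(k < N.+1)
       (circle a rho t - b)^-1 ^+ k.+1 * c b k) ->
  circle_integral f a rho = (2 * pi%:C * 'i%C) * c a ord0.
Proof.
move=> uu au rho0 sep fE; rewrite /circle_integral -/(cint _).
have sep' b : b \in u -> b = a \/ rho < normc (b - a).
  by move=> bu; case: (eqVneq b a); [left|right; apply: sep].
pose F b (k : 'I_N.+1) := circle_form (fun z => (z - b)^-1 ^+ k.+1) a rho.
(* Extended by 0 so that continuity holds for every index b. *)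
pose G b (k : 'I_N.+1) t := if b \in u then c b k * F b k t else 0.
have Gc b k : ccont (G b k).
  rewrite /G; case: (boolP (b \in u)) => bu; last exact: ccont_cst.
  by apply: ccontM; [exact: ccont_cst|apply: ccont_circle_form => //; apply: sep'].
have -> : (fun t => f (circle a rho t) * ('i%C * rho%:C * cis t)) =
    (fun t => \sum_(b <- u) \sum_(k < N.+1) G b k t).
  apply/funext=> t; rewrite fE mulr_suml [LHS]big_seq [RHS]big_seq.
  apply: eq_bigr => b bu; rewrite mulr_suml; apply: eq_bigr => k _.
  by rewrite /G bu /F /circle_form mulrA [c b k * _]mulrC.
rewrite cint_sum; last by move=> b; apply: ccont_sum.
have E b k : b \in u ->
    cint (G b k) = if (b == a) && (k == 0 :> nat)%N then (2 * pi%:C * 'i%C) * c b k else 0.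
  move=> bu; have -> : G b k = (fun t => c b k * F b k t) by rewrite /G bu.
  rewrite cintZ; last by apply: ccont_circle_form => //; apply: sep'.
  have -> : cint (F b k) = _ := circle_integral_pole k rho0 (sep' b bu).
  by case: ifP => _; rewrite ?mulr0 // mulrC.
rewrite (bigD1_seq a) //= [X in _ + X]big_seq_cond [X in _ + X]big1 ?addr0; last first.
  move=> b /andP[bu ba]; rewrite cint_sum //.
  by rewrite big1 // => k _; rewrite E // (negPf ba).
rewrite cint_sum // (bigD1 ord0) //= big1 ?addr0 ?E ?eqxx // => k k0.
rewrite E // eqxx /=; case: eqP => // k00;
  by move/eqP: k0; case; apply: ord_inj.
Qed.

(** The integral around an eigenvalue a extracts the residue of the resolvent,
which is the spectral projection of a; the sum over the eigenvalues in Omega is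
an idempotent whose rank is given by [spectral_rank]. *)
Lemma riesz_dimE n (A : 'M[C]_n) s Omega : eigenlist A s ->
  riesz_dim A Omega = count (fun a => `[< Omega a >]) s.
Proof.
case: n A => [|n] A As.
  have := eigenlist_size As; case: s As => // _ _.
  by rewrite /riesz_dim /= [riesz_idempotent _ _]thinmx0 mxrank0.
have [N sN] : exists N, size s = N.+1.
  by rewrite -(eigenlist_size As); exists n.
have [p pP] := choice (spectral_poly (undup s) (size s)).
have p1 a : ('X - a%:P) ^+ size s %| p a - 1 by case: (pP a).
have p0 a b : b \in undup s -> b != a -> ('X - b%:P) ^+ size s %| p a.
  by move=> bu ba; case: (pP a) => _; apply.
have [rho0 sep] := riesz_radiusP As; rewrite (spectrumE As) /= in sep.
rewrite -(spectral_rank As p1 p0); congr (\rank _).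
have E a : a \in undup s -> \matrix_(i, j) ((2 * pi%:C * 'i%C)^-1 *
    circle_integral (fun z => invmx (z%:M - A) i j) a (riesz_radius A)) =
    horner_mx A (p a).
  move=> au; apply/matrixP=> i j; rewrite mxE.
  pose c b (k : 'I_N.+1) := horner_mx A (('X - b%:P) ^+ k * p b) i j.
  rewrite (@circle_integral_resolvent (undup s) N c) ?undup_uniq //.
  - rewrite mulKf; last first.
      rewrite !mulf_neq0 ?pnatr_eq0 //; last by rewrite eq_complex /= oner_eq0 andbF.
      by rewrite -normc_gt0 normcR normr_gt0 gt_eqF ?pi_gt0.
    by rewrite /c expr0 mul1r.
  - move=> b bu /eqP ba; rewrite mem_undup in bu.
    rewrite mem_undup in au.
    by have := sep b a bu au ba; apply: lt_trans; rewrite ltrDl.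
  move=> t; rewrite (spectral_resolvent As p1 p0).
    rewrite summxE; apply: eq_bigr => b _; rewrite sN summxE.
    by apply: eq_bigr => k _; rewrite mxE.
  apply/negP => zs; have e : normc (circle a (riesz_radius A) t - a) = riesz_radius A.
    rewrite /circle addrAC subrr add0r Normc.normcM normcR normc_cis mulr1.
    by rewrite gtr0_norm.
  have : circle a (riesz_radius A) t <> a.
    by move=> za; move: e rho0; rewrite za subrr Normc.normc0 => <-; rewrite ltxx.
  move=> /(sep _ _ zs); rewrite e -mem_undup => /(_ au).
  by rewrite gtrDl ltNge (ltW rho0).
rewrite /riesz_idempotent rmorph_sum /= -[RHS]big_filter.
have -> : spectrum A `&` Omega = [set` [seq a <- undup s | `[< Omega a >]]].
  rewrite (spectrumE As); apply/seteqP; split=> a /=; rewrite mem_filter mem_undup.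
    by move=> [-> Oa]; rewrite andbT; apply/asboolP.
  by move=> /andP[/asboolP].
rewrite -fsbig_seq ?filter_uniq ?undup_uniq //.
rewrite [LHS]big_seq [RHS]big_seq; apply: eq_bigr => a.
by rewrite mem_filter => /andP[_ au]; apply: E.
Qed.
End RieszDimension.

(** * Balanced matrices *)

Section Balanced.
Variable R : realType.
Local Notation C := R[i].
Local Notation normc := Normc.normc.

Lemma normCE (z : C) : `|z| = (normc z)%:C.
Proof. by []. Qed.

Lemma open_normc_lt (a : C) (d : R) : open ([set z | normc (z - a) < d] : set C^o).
Proof.
rewrite openE => z /= zd; apply/nbhs_ballP; exists (d - normc (z - a))%:C => /=.
  by rewrite ltcR subr_gt0.
move=> y; rewrite /ball /= normCE ltcR => zy.
rewrite -(subrK z y) -addrA (le_lt_trans (le_normcD _ _)) // -ltrBrDr.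
by rewrite -normcN opprB.
Qed.

Lemma open_normc_gt (a : C) (d : R) : open ([set z | d < normc (z - a)] : set C^o).
Proof.
rewrite openE => z /= zd; apply/nbhs_ballP; exists (normc (z - a) - d)%:C => /=.
  by rewrite ltcR subr_gt0.
move=> y; rewrite /ball /= normCE ltcR => zy.
have h := normc_distl (z - a) (z - y).
have e : z - a - (z - y) = y - a by ring.
by rewrite e in h; lra.
Qed.

Lemma continuous_sum (T : topologicalType) (I : Type) (r : seq I) (P : pred I)
    (f : I -> T -> C^o) : (forall i, continuous (f i)) ->
  continuous (fun x => \sum_(i <- r | P i) f i x : C^o).
Proof.
move=> fc; elim: r => [|i r IH] x.
  by under eq_fun do rewrite big_nil; apply: cvg_cst.
under eq_fun do rewrite big_cons.
case: (P i); last exact: IH.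
by apply: cvgD; [exact: fc|exact: IH].
Qed.

Lemma continuous_prod (T : topologicalType) (I : Type) (r : seq I) (P : pred I)
    (f : I -> T -> C^o) : (forall i, continuous (f i)) ->
  continuous (fun x => \prod_(i <- r | P i) f i x : C^o).
Proof.
move=> fc; elim: r => [|i r IH] x.
  by under eq_fun do rewrite big_nil; apply: cvg_cst.
under eq_fun do rewrite big_cons.
case: (P i); last exact: IH.
by apply: cvgM; [exact: fc|exact: IH].
Qed.

Lemma continuous_coef (m n : nat) (c : C) i j :
  continuous (fun y : 'M[C^o]_(m, n) => c * y i j : C^o).
Proof.
move=> y; have h := @coord_continuous C m n i j y.
have := @cvgM _ _ (nbhs y) _ (fun=> (c : C^o)) (fun y : 'M[C^o]_(m,n) => y i j : C^o) c (y i j).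
apply; last exact: h.
exact: (@cvg_cst _ (c : C^o) _ (nbhs y)).
Qed.

(** The range is cut out by finitely many linear equations, the columns of a
cokernel matrix. *)
Lemma range_closed n (A : 'M[C]_n) :
  closed ([set A *m x | x in [set: 'cV[C]_n]] : set 'cV[C^o]_n).
Proof.
set Q := cokermx A^T.
have -> : [set A *m x | x in [set: 'cV[C]_n]] =
    \bigcap_(j in [set: 'I_n])
      ((fun y : 'cV[C^o]_n => (\sum_i Q i j * y i 0 : C^o)) @^-1` [set 0]).
  apply/seteqP; split=> y /=.
    move=> [x _ <-] j _ /=.
    have := mulmx_coker A^T; rewrite -/Q => /(congr1 (mulmx x^T)).
    rewrite mulmx0 mulmxA -trmx_mul => /matrixP/(_ 0 j).
    rewrite mxE [RHS]mxE => e; rewrite -[RHS]e.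
    by apply: eq_bigr => i _; rewrite [in RHS]mxE mulrC.
  move=> h; have : (y^T <= A^T)%MS.
    rewrite submxE -/Q; apply/eqP/matrixP=> i j; rewrite ord1 !mxE.
    by rewrite -[RHS](h j) //; apply: eq_bigr => k _; rewrite mxE mulrC.
  by move=> /submxP[D yD]; exists D^T => //; rewrite -[RHS]trmxK yD trmx_mul trmxK.
apply: closed_bigI => j _; apply: preimage_closed.
  move=> y _; apply: (@continuous_sum _ _ _ _ (fun i (y : 'cV[C^o]_n) => Q i j * y i 0)).
  by move=> i; apply: continuous_coef.
exact: (accessible_closed_set1 (hausdorff_accessible (@norm_hausdorff C C^o))).
Qed.

Lemma semi_fredholm_mx n (A : 'M[C]_n) : semi_fredholm A.
Proof. by split; [exact: range_closed|rewrite minEle; case: ifP => _; rewrite ltry]. Qed.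

Lemma dimkerE n (A : 'M[C]_n) : dimker A = (n - \rank A)%N.
Proof. by rewrite /dimker mxrank_ker mxrank_tr. Qed.

Lemma fredholm_index_mx n (A : 'M[C]_n) : fredholm_index A = 0.
Proof.
by rewrite /fredholm_index !dimkerE mxrank_map mxrank_tr subrr.
Qed.

Lemma perm_opp_count (s : seq C) :
  (forall a, count_mem a s = count_mem (- a) s) -> perm_eq s (map -%R s).
Proof.
move=> h; apply/allP => a _ /=; rewrite h count_map; apply/eqP.
by apply: eq_count => b /=; rewrite eqr_oppLR.
Qed.

Lemma isolation_radius (s : seq C) a : exists2 d : R, 0 < d &
  forall b, b \in s -> b != a -> d < normc (b - a).
Proof.
have [|d d0 H] := @pos_lower_bound R [seq normc (b - a) | b <- s & b != a].
  move=> x /mapP[b]; rewrite mem_filter => /andP[ba _] ->.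
  by rewrite normc_gt0 subr_eq0.
by exists d => // b bs ba; apply: H; apply: map_f; rewrite mem_filter ba.
Qed.

(** A small disc around a, together with the exterior of that disc, is an
admissible pair of open sets: it compares the multiplicities of a and - a. *)
Lemma balancedP n (B : 'M[C]_n) s : eigenlist B s ->
  balanced B <-> perm_eq s (map -%R s).
Proof.
move=> Bs; split=> [[_ h _]|sym].
  apply: perm_opp_count => a.
  have [d1 d10 H1] := isolation_radius s a; have [d2 d20 H2] := isolation_radius s (- a).
  (* The disc isolates a, and its opposite isolates - a. *)
  pose d := Num.min d1 d2; have d0 : 0 < d by rewrite lt_min d10.
  have := h [set z | normc (z - a) < d] [set z | d < normc (z - a)]
    (@open_normc_lt _ _) (@open_normc_gt _ _).
  rewrite !(riesz_dimE _ Bs) => e.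
  have e1 : count (fun b => `[< normc (b - a) < d >]) s = count_mem a s.
    apply: eq_in_count => b bs /=; rewrite asboolb.
    case: (eqVneq b a) => [->|/(H1 b bs) h1]; first by rewrite subrr Normc.normc0.
    by apply/negbTE; rewrite -leNgt ltW // (le_lt_trans _ h1) // ge_min lexx.
  have e2 : count (fun b => `[< oppset [set z | normc (z - a) < d] b >]) s =
      count_mem (- a) s.
    apply: eq_in_count => b bs /=; apply/asboolP/eqP => [[z zd zb]|->].
      apply/eqP; apply: contraLR zd => ba; rewrite -leNgt.
      have := H2 b bs ba; rewrite -zb opprK addrC -opprB normcN => /ltW.
      by apply: le_trans; rewrite ge_min lexx orbT.
    by exists a; rewrite ?opprK //= subrr Normc.normc0.
  rewrite -e1 -e2; apply: e.
    by apply/seteqP; split=> // z /= [] /ltW; rewrite leNgt => /negP.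
  move=> z; rewrite (spectrumE Bs) /= => zs.
  case: (eqVneq z a) => [->|za]; [left|right]; rewrite /= ?subrr ?Normc.normc0 //.
  by rewrite (le_lt_trans _ (H1 z zs za)) // ge_min lexx.
have mem_opp a : (- a \in s) = (a \in s).
  by rewrite (perm_mem sym) mem_map //; apply: oppr_inj.
split.
- have e a : (- B - a%:M \notin unitmx) = (a \in s).
    have -> : - B - a%:M = -1 *: (B - (- a)%:M) by rewrite scaleN1r raddfN /= opprK opprD.
    by rewrite unitmxZ ?unitrN1 // (eigenlist_unit _ Bs) negbK mem_opp.
  by rewrite (spectrumE Bs); apply/seteqP; split=> a; rewrite /spectrum /= e.
- move=> O1 O2 _ _ _ _; rewrite !(riesz_dimE _ Bs).
  move/permP: (sym) => ->; rewrite count_map; apply: eq_count => a /=.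
  apply/asbool_equiv_eq; split=> [Oa|[z Oz <-]]; last by rewrite opprK.
  by exists (- a); rewrite ?opprK.
move=> a; split; first by split=> _; apply: semi_fredholm_mx.
by rewrite !fredholm_index_mx.
Qed.
End Balanced.

(** * The entrywise norm *)

Section EntrySum.
Variable R : realType.
Local Notation C := R[i].
Local Notation normc := Normc.normc.

(** Any norm defines the same closure; this one is submultiplicative also
for rectangular matrices and additive over blocks. *)
Definition mx1norm m n (A : 'M[C]_(m, n)) : R := \sum_i \sum_j normc (A i j).

Lemma mx1norm_ge0 m n (A : 'M[C]_(m, n)) : 0 <= mx1norm A.
Proof. by apply: sumr_ge0 => i _; apply: sumr_ge0 => j _; apply: normc_ge0. Qed.

Lemma normc_sum (I : finType) (F : I -> C) : normc (\sum_i F i) <= \sum_i normc (F i).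
Proof.
elim/big_rec2: _ => [|i x y _ h]; first by rewrite Normc.normc0.
by rewrite (le_trans (le_normcD _ _)) // lerD2l.
Qed.

Lemma normc_entry_le m n (A : 'M[C]_(m, n)) i j : normc (A i j) <= mx1norm A.
Proof.
rewrite /mx1norm (bigD1 i) //= (bigD1 j) //= -addrA lerDl addr_ge0 //.
  by apply: sumr_ge0 => *; apply: normc_ge0.
by apply: sumr_ge0 => *; apply: sumr_ge0 => *; apply: normc_ge0.
Qed.

Lemma mx1normM m n p (A : 'M[C]_(m, n)) (B : 'M[C]_(n, p)) :
  mx1norm (A *m B) <= mx1norm A * mx1norm B.
Proof.
rewrite /mx1norm mulr_suml; apply: ler_sum => i _.
apply: (@le_trans _ _ (\sum_j \sum_k normc (A i k) * normc (B k j))).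
  apply: ler_sum => j _; rewrite mxE (le_trans (normc_sum _)) //.
  by apply: ler_sum => k _; rewrite Normc.normcM.
rewrite exchange_big mulr_suml; apply: ler_sum => k _ /=.
rewrite -mulr_sumr ler_wpM2l ?normc_ge0 // (bigD1 k) //= lerDl.
by apply: sumr_ge0 => *; apply: sumr_ge0 => *; apply: normc_ge0.
Qed.

Lemma mx1norm_block m1 m2 n1 n2 (A : 'M[C]_(m1, n1)) (B : 'M[C]_(m1, n2))
    (D : 'M[C]_(m2, n1)) (E : 'M[C]_(m2, n2)) :
  mx1norm (block_mx A B D E) = mx1norm A + mx1norm B + (mx1norm D + mx1norm E).
Proof.
rewrite /mx1norm big_split_ord /= -!big_split /=; congr (_ + _); apply: eq_bigr => i _;
rewrite big_split_ord /=; congr (_ + _); apply: eq_bigr => j _;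
by rewrite ?block_mxEul ?block_mxEur ?block_mxEdl ?block_mxEdr.
Qed.

Lemma mx1norm0 m n : mx1norm (0 : 'M[C]_(m, n)) = 0.
Proof. by apply: big1 => i _; apply: big1 => j _; rewrite mxE Normc.normc0. Qed.

Lemma l2norm_ge n (x : 'cV[C]_n) i : normc (x i 0) <= l2norm x.
Proof.
rewrite /l2norm -[leLHS]ger0_norm ?normc_ge0 // -sqrtr_sqr ler_wsqrtr //.
by rewrite (bigD1 i) //= lerDl sumr_ge0 // => *; rewrite sqr_ge0.
Qed.

Lemma l2norm_le n (x : 'cV[C]_n) : l2norm x <= \sum_i normc (x i 0).
Proof.
have s0 : 0 <= \sum_i normc (x i 0) by apply: sumr_ge0 => *; apply: normc_ge0.
rewrite /l2norm -[leRHS]ger0_norm // -sqrtr_sqr ler_wsqrtr //.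
rewrite expr2 mulr_suml; apply: ler_sum => i _.
rewrite expr2 ler_wpM2l ?normc_ge0 // (bigD1 i) //= lerDl.
by apply: sumr_ge0 => *; apply: normc_ge0.
Qed.

Lemma l2norm_mul_le n (A : 'M[C]_n) (x : 'cV[C]_n) :
  l2norm x <= 1 -> l2norm (A *m x) <= mx1norm A.
Proof.
move=> x1; apply: le_trans (l2norm_le _) _; apply: ler_sum => i _.
rewrite mxE (le_trans (normc_sum _)) //; apply: ler_sum => j _.
by rewrite Normc.normcM ler_piMr ?normc_ge0 // (le_trans (l2norm_ge x j)).
Qed.

Lemma opnorm_le n (A : 'M[C]_n) : opnorm A <= mx1norm A.
Proof.
apply: sup_le_ub; last by move=> _ [x x1 <-]; apply: l2norm_mul_le.
exists (l2norm (A *m 0)), 0 => //=; rewrite /l2norm big1 ?sqrtr0 ?ler01 // => i _.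
by rewrite mxE Normc.normc0 expr0n.
Qed.

Lemma normc_entry_opnorm n (A : 'M[C]_n) i j : normc (A i j) <= opnorm A.
Proof.
have e1 : l2norm (delta_mx j 0 : 'cV[C]_n) <= 1.
  rewrite (le_trans (l2norm_le _)) // (bigD1 j) //= big1 ?addr0 => [|k kj].
    by rewrite mxE !eqxx Normc.normc1.
  by rewrite mxE (negPf kj) Normc.normc0.
have : normc (A i j) <= l2norm (A *m delta_mx j 0).
  by rewrite -colE (le_trans _ (l2norm_ge _ i)) // mxE.
move/le_trans; apply; apply: sup_upper_bound; last by exists (delta_mx j 0).
split; first by exists (l2norm (A *m delta_mx j 0)), (delta_mx j 0).
by exists (mx1norm A) => _ [x x1 <-]; apply: l2norm_mul_le.
Qed.

Lemma mx1norm_le_opnorm n (A : 'M[C]_n) : mx1norm A <= (n * n)%:R * opnorm A.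
Proof.
rewrite /mx1norm.
apply: (@le_trans _ _ (\sum_(i < n) \sum_(j < n) opnorm A)).
  by apply: ler_sum => i _; apply: ler_sum => j _; apply: normc_entry_opnorm.
by rewrite !sumr_const !card_ord -mulrnA mulr_natl.
Qed.

(** The operator norm lies between the largest modulus of an entry and the sum
of all the moduli. *)
Lemma norm_closureP n (S : set 'M[C]_n) A : norm_closure S A <->
  forall eps : R, 0 < eps -> exists2 X, S X & mx1norm (A - X) < eps.
Proof.
split=> h eps e0; last first.
  by have [X SX AX] := h eps e0; exists X => //; apply: le_lt_trans (opnorm_le _) AX.
have p : 0 < (n * n).+1%:R :> R by [].
have [X SX AX] := h (eps / (n * n).+1%:R) (divr_gt0 e0 p); exists X => //.
case: n S A h p X SX AX => [|n] S A h p X SX AX; first by rewrite /mx1norm big_ord0.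
apply: le_lt_trans (mx1norm_le_opnorm _) _.
move: AX; rewrite ltr_pdivlMr // mulrC; apply: le_lt_trans.
rewrite ler_wpM2r // ?ler_nat // (le_trans (normc_ge0 ((A - X) ord0 ord0))) //.
exact: normc_entry_opnorm.
Qed.
End EntrySum.

(** * Approximation by differences of idempotents *)

Section Approximation.
Variable R : realType.
Local Notation C := R[i].
Local Notation normc := Normc.normc.

Lemma diff_idempotent_similar n m (X : 'M[C]_n) (Y : 'M[C]_m) :
  similar_mx X Y -> diff_idempotent_mx X -> diff_idempotent_mx Y.
Proof.
move=> [P [Q [PQ QP PX]]] [E EE [F FF EF]].
have PGQ (G : 'M[C]_n) : G *m G = G -> P *m G *m Q *m (P *m G *m Q) = P *m G *m Q.
  by move=> GG; rewrite -!mulmxA (mulmxA Q) QP mul1mx (mulmxA G) GG.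
exists (P *m E *m Q); first exact: PGQ.
exists (P *m F *m Q); first exact: PGQ.
by rewrite -mulmxBl -mulmxBr EF PX -mulmxA PQ mulmx1.
Qed.

Lemma diff_idempotent_block n m (X : 'M[C]_n) (Y : 'M[C]_m) :
  diff_idempotent_mx X -> diff_idempotent_mx Y ->
  diff_idempotent_mx (block_mx X 0 0 Y).
Proof.
move=> [E EE [F FF EF]] [E' EE' [F' FF' EF']].
have blk (G : 'M[C]_n) (G' : 'M[C]_m) : G *m G = G -> G' *m G' = G' ->
    block_mx G 0 0 G' *m block_mx G 0 0 G' = block_mx G 0 0 G'.
  by move=> GG GG'; rewrite mulmx_block !mulmx0 !mul0mx !addr0 !add0r GG GG'.
exists (block_mx E 0 0 E'); first exact: blk.
exists (block_mx F 0 0 F'); first exact: blk.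
by rewrite opp_block_mx add_block_mx EF EF' !oppr0 !addr0.
Qed.

(** Two idempotents [[a, b], [1, 1 - a]] with the same b = a (1 - a) differ by
a diagonal matrix; the values a = (1 - l) / 2 and a = (1 + l) / 2 give the same b
and the difference diag (- l, l). *)
Lemma diff_idempotent_pair (l : C) :
  diff_idempotent_mx (block_mx (- l)%:M 0 0 l%:M : 'M[C]_(1 + 1)).
Proof.
pose G (a : C) : 'M[C]_(1 + 1) :=
  block_mx a%:M ((1 - l ^+ 2) / 4)%:M 1%:M (1 - a)%:M.
have GG a : a * (1 - a) = (1 - l ^+ 2) / 4 -> G a *m G a = G a.
  move=> e; rewrite /G -e mulmx_block -!scalar_mxM -!raddfD /=.
  by congr block_mx; congr (_%:M); ring.
exists (G ((1 - l) / 2)); first by apply: GG; field.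
exists (G ((1 + l) / 2)); first by apply: GG; field.
rewrite /G opp_block_mx add_block_mx !subrr -!raddfB /=.
by congr block_mx; congr (_%:M); field.
Qed.

Lemma diff_idempotent0 n : diff_idempotent_mx (0 : 'M[C]_n).
Proof. by exists 0; [|exists 0]; rewrite /idempotent_mx /= ?mulmx0 ?subrr. Qed.

Lemma diff_idempotent1 n : diff_idempotent_mx (1%:M : 'M[C]_n).
Proof. by exists 1%:M; [|exists 0]; rewrite /idempotent_mx /= ?mulmx0 ?mulmx1 ?subr0. Qed.

(** Pigeonhole: infinitely many of the points l - d / k lie in the disc. *)
Lemma approx_avoiding (bad : seq C) (l : C) (d : R) : 0 < d ->
  exists2 l' : C, l' \notin bad & normc (l - l') < d.
Proof.
move=> d0; pose f (k : nat) : C := l - (d / k.+2%:R)%:C.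
have f_inj : injective f.
  move=> i j /addrI/oppr_inj/complexI/(mulfI (lt0r_neq0 d0))/invr_inj/eqP.
  by rewrite eqr_nat => /eqP[].
have /allPn[x xf xbad] : ~~ all [in bad] (map f (iota 0 (size bad).+1)).
  apply/negP => /allP sub.
  have := uniq_leq_size (_ : uniq (map f (iota 0 (size bad).+1))) sub.
  by rewrite (map_inj_uniq f_inj) iota_uniq size_map size_iota ltnn => /(_ isT).
exists x => //; case/mapP: xf => k _ ->.
rewrite /f opprB addrCA subrr addr0 normcR gtr0_norm ?divr_gt0 //.
by rewrite ltr_pdivrMr // ltr_pMr // ltr1n.
Qed.

Lemma eigenlist_exists n (A : 'M[C]_n) : exists s, eigenlist A s.
Proof.
have [s e] := closed_field_poly_normal (char_poly A); exists s.
by rewrite /eigenlist [LHS]e (monicP (char_poly_monic A)) scale1r.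
Qed.

(** A nonzero a differs from - a, so both can be removed; if all the entries
vanish, two zeros are removed instead. *)
Lemma symmetric_pair (s : seq C) : perm_eq s (map -%R s) -> (1 < size s)%N ->
  exists l s', perm_eq s [:: l, - l & s'] /\ perm_eq s' (map -%R s').
Proof.
move=> sym s1.
suff [l [s' ss']] : exists l s', perm_eq s [:: l, - l & s'].
  exists l, s'; split=> //.
  have := perm_trans (perm_trans _ sym) (perm_map -%R ss').
  move/(_ [:: l, - l & s']); rewrite perm_sym => /(_ ss') /=.
  rewrite opprK -[_ :: _ :: s']/([:: l; - l] ++ s').
  rewrite -[- l :: _ :: _]/([:: - l; l] ++ map -%R s') => h.
  rewrite -(perm_cat2l [:: l; - l]) (perm_trans h) // perm_cat2r.
  by rewrite (perm_catC [:: - l] [:: l]).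
have [/allP z|/allPn[a a_s a0]] := boolP (all (pred1 0) s).
  case: s z s1 {sym} => [|x [|y s]] // z _; exists 0, s.
  have /eqP x0 : x == 0 by apply: z; rewrite mem_head.
  have /eqP y0 : y == 0 by apply: z; rewrite !inE eqxx orbT.
  by rewrite x0 y0 oppr0.
exists a, (rem (- a) (rem a s)); apply: (perm_trans (perm_to_rem a_s)).
rewrite perm_cons; apply: perm_to_rem.
have : - a \in s by rewrite (perm_mem sym) map_f.
rewrite (perm_mem (perm_to_rem a_s)) inE eq_sym -subr_eq0 opprK -mulr2n.
by rewrite mulrn_eq0 /= (negPf (a0 : a != 0)).
Qed.

Lemma symmetric_small (s : seq C) : perm_eq s (map -%R s) -> (size s <= 1)%N ->
  s = [::] \/ s = [:: 0].
Proof.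
case: s => [|a [|//]] /=; first by left.
move=> /perm_mem/(_ a); rewrite !inE eqxx => /esym; rewrite -addr_eq0 -mulr2n.
by rewrite mulrn_eq0 /= => /eqP -> _; right.
Qed.

(** Induction on the number of eigenvalues.  A pair l, - l is peeled off, the
remaining block M2 is approximated by M2', and l is moved to a nearby l' such
that l', - l' and the eigenvalues of M2' are separated: the triangular matrix
then decouples into M2' and diag (- l', l').  Invertibility of M' - 1 is part of
the statement because a block 1_r has to be decoupled from M' afterwards. *)
Lemma approx_symmetric s m (M : 'M[C]_m) (eps : R) : eigenlist M s ->
  perm_eq s (map -%R s) -> 0 < eps ->
  exists M', [/\ diff_idempotent_mx M', M' - 1%:M \in unitmx &
    mx1norm (M - M') < eps].
Proof.
have [k] := ubnP (size s); elim: k s m M eps => // k IH s m M eps sk Ms sym e0.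
have [s1|s1] := leqP (size s) 1.
  have M0 : M = 0.
    have [s0|s0] := symmetric_small sym s1; subst s.
      by have /= m0 := eigenlist_size Ms; subst m; apply: thinmx0.
    have /= m1 := eigenlist_size Ms; subst m.
    have := trace_exp 1 Ms; rewrite big_seq1 expr1 => tr.
    by rewrite [M]mx11_scalar -trace_mx11 tr raddf0.
  exists 0; rewrite M0 subrr mx1norm0; split=> //; first exact: diff_idempotent0.
  by rewrite sub0r -scaleN1r unitmxZ ?unitrN1 ?unitmx1.
have [l [s' [ss' sym']]] := symmetric_pair sym s1.
have [m1 [M1 [c1 [sM1 M1s]]]] := eigenlist_peel (iffRL (eigenlist_perm _ Ms) ss').
have [m2 [M2 [c2 [sM2 M2s]]]] := eigenlist_peel M1s.
have [c3 sM3] := similar_ublock c1 sM2 (similar_refl (@scalar_mx C 1 l)).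
have [P [Q [PQ QP PM]]] := similar_trans sM1 sM3.
(* The triangular form of M, with the diagonal blocks X, - x, x. *)
pose W (X : 'M[C]_m2) (x : C) : 'M[C]_(m2 + 1 + 1) :=
  block_mx (block_mx X c2 0 (- x)%:M) c3 0 x%:M.
have MW : M = Q *m W M2 l *m P by rewrite -mulmxA -PM mulmxA QP mul1mx.
have [d d0 dP] : exists2 d : R, 0 < d &
    forall x, x < d + (d + d) -> mx1norm Q * x * mx1norm P < eps.
  pose q := mx1norm Q * mx1norm P + 1.
  have q0 : 0 < q by rewrite ltr_wpDl // mulr_ge0 ?mx1norm_ge0.
  exists (eps / q / 3); first by rewrite !divr_gt0.
  move=> x xd; rewrite mulrAC; have xq : x < eps / q by lra.
  have [x0|x0] := leP x 0.
    by rewrite (le_lt_trans _ e0) // mulr_ge0_le0 // mulr_ge0 ?mx1norm_ge0.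
  apply: (@lt_trans _ _ (q * x)); first by rewrite ltr_pM2r // ltrDl.
  by rewrite mulrC -ltr_pdivlMr.
have [|M2' [diM2 uM2 NM2]] := IH s' m2 M2 d _ M2s sym' d0.
  by move: sk; rewrite (perm_size ss') /= !ltnS => /ltnW.
have [s2 M2s2] := eigenlist_exists M2'.
(* Avoiding 0 separates l' from - l', avoiding 1 and -1 keeps M' - 1
     invertible. *)
have [l' bad ll'] := approx_avoiding (0 :: 1 :: -1 :: s2 ++ map -%R s2) l d0.
move: bad; rewrite !inE !negb_or mem_cat negb_or => /and5P[l0 l1 l2 l3 l4].
have s24 : - l' \notin s2.
  by apply: contraNN l4 => h; apply/mapP; exists (- l'); rewrite ?opprK.
have Ws : eigenlist (W M2' l') ((s2 ++ [:: - l']) ++ [:: l']).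
  apply: eigenlist_ublock (eigenlist_scalar 1 _).
  exact: eigenlist_ublock (eigenlist_scalar 1 _).
have sW : similar_mx (W M2' l') (Q *m W M2' l' *m P).
  by exists Q, P; split=> //; rewrite -[RHS]mulmxA PQ mulmx1.
exists (Q *m W M2' l' *m P); split.
- apply: (diff_idempotent_similar sW).
  have k1 : similar_mx (W M2' l')
      (block_mx (block_mx M2' c2 0 (- l')%:M) 0 0 (@scalar_mx C 1 l')).
    rewrite /W; apply: similar_decouple.
    rewrite (eigenlist_unit _ (eigenlist_ublock _ M2s2 (eigenlist_scalar 1 _))).
    rewrite mem_cat negb_or l3 inE -addr_eq0 -mulr2n mulrn_eq0 //.
  have k2 : similar_mx (block_mx M2' c2 0 (- l')%:M) (block_mx M2' 0 0 (@scalar_mx C 1 (- l'))).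
    by apply: similar_decouple; rewrite (eigenlist_unit _ M2s2).
  have k3 := similar_trans k1 (similar_dblock k2 (similar_refl (@scalar_mx C 1 l'))).
  apply: (diff_idempotent_similar (similar_sym k3)).
  have := similar_blockA M2' (@scalar_mx C 1 (- l')) (@scalar_mx C 1 l') 0 0 0.
  rewrite col_mx0 row_mx0 => /similar_sym k4.
  apply: (diff_idempotent_similar k4).
  by apply: diff_idempotent_block => //; apply: diff_idempotent_pair.
- rewrite (eigenlist_unit _ (iffLR (eigenlist_similar _ sW) Ws)) !mem_cat !negb_or.
  rewrite -(eigenlist_unit _ M2s2) uM2 /= !andbT.
  by rewrite eq_sym eqr_oppLR l2 eq_sym l1.
rewrite MW -mulmxBl -mulmxBr.
apply: le_lt_trans (mx1normM _ _) _.
apply: le_lt_trans (ler_wpM2r (mx1norm_ge0 _) (mx1normM _ _)) _; apply: dP.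
rewrite /W opp_block_mx add_block_mx mx1norm_block subrr oppr0 addr0 !mx1norm0.
rewrite opp_block_mx add_block_mx mx1norm_block subrr oppr0 addr0 !mx1norm0 !addr0 !add0r.
have n1 (x : C) : mx1norm (@scalar_mx C 1 x) = normc x.
  by rewrite /mx1norm !big_ord1 mxE eqxx.
rewrite -!raddfB /= !n1 mx1norm0 add0r normcN -addrA.
by rewrite ltrD // ltrD.
Qed.
End Approximation.

Section Sufficiency.
Variable R : realType.
Local Notation C := R[i].
Local Notation normc := Normc.normc.

(** The rank condition provides r independent eigenvectors for 1; they are
split off as a block 1_r, which is itself an idempotent, and the complementary
block is approximated. *)
Lemma closure_of_eigenlist n (T : 'M[C]_n) r s :
  eigenlist T (s ++ nseq r 1) -> perm_eq s (map -%R s) ->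
  (\rank (T - 1%:M)%R + r <= n)%N -> norm_closure (@diff_idempotent_mx R n) T.
Proof.
move=> Ts sym rk; apply/norm_closureP => eps e0.
have := eigenlist_size Ts; rewrite size_cat size_nseq => en; subst n.
rewrite leq_add2r in rk.
have [M [c sT]] := similar_deflate rk.
have Ms : eigenlist M s.
  have := iffLR (eigenlist_similar _ sT) Ts.
  rewrite /eigenlist char_poly_ublock char_poly_scalar big_cat /= big_nseq.
  rewrite -Monoid.iteropE; apply: mulIf.
  by rewrite expf_neq0 // polyXsubC_eq0.
have [P [Q [PQ QP PT]]] := sT.
pose q := mx1norm Q * mx1norm P + 1.
have q0 : 0 < q by rewrite ltr_wpDl // mulr_ge0 ?mx1norm_ge0.
have [M' [diM' uM' NM']] := approx_symmetric Ms sym (divr_gt0 e0 q0).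
pose W (X : 'M[C]_(size s)) := block_mx X c 0 (@scalar_mx C r 1).
exists (Q *m W M' *m P).
  have sW : similar_mx (W M') (Q *m W M' *m P).
    by exists Q, P; split=> //; rewrite -[RHS]mulmxA PQ mulmx1.
  apply: (diff_idempotent_similar sW).
  apply: (diff_idempotent_similar (similar_sym (similar_decouple c uM'))).
  by apply: diff_idempotent_block => //; apply: diff_idempotent1.
have -> : T = Q *m W M *m P by rewrite -mulmxA -PT mulmxA QP mul1mx.
rewrite -mulmxBl -mulmxBr (le_lt_trans (mx1normM _ _)) //.
apply: le_lt_trans (ler_wpM2r (mx1norm_ge0 _) (mx1normM _ _)) _.
have -> : mx1norm (W M - W M') = mx1norm (M - M').
  by rewrite /W opp_block_mx add_block_mx mx1norm_block !subrr !mx1norm0 !addr0.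
rewrite mulrAC; have := mx1norm_ge0 (M - M'); rewrite le_eqVlt => /orP[/eqP <-|N0].
  by rewrite mulr0.
apply: (@lt_trans _ _ (q * mx1norm (M - M'))); first by rewrite ltr_pM2r // ltrDl.
by rewrite mulrC -ltr_pdivlMr.
Qed.

Lemma perm_nseq_pm1 (s : seq C) : {in s, forall a, a = 1 \/ a = -1} ->
  exists p q, perm_eq s (nseq p 1 ++ nseq q (-1)).
Proof.
elim: s => [|a s IH] h; first by exists 0%N, 0%N.
have [|p [q spq]] := IH; first by move=> b bs; apply: h; rewrite inE bs orbT.
have [->|->] := h a (mem_head _ _).
  by exists p.+1, q; rewrite /= perm_cons.
by exists p, q.+1; rewrite /= -[-1 :: nseq q _]cat1s perm_sym perm_catCA perm_cons perm_sym.
Qed.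

Lemma sum_symmetric (s : seq C) : perm_eq s (map -%R s) -> \sum_(a <- s) a = 0.
Proof.
move=> sym; have : \sum_(a <- s) a = - \sum_(a <- s) a.
  by rewrite {1}(perm_big _ sym) big_map sumrN.
by move/eqP; rewrite -addr_eq0 -mulr2n mulrn_eq0 => /eqP.
Qed.

(** A symmetric list has sum 0, so tr T = r says that the eigenvalue 1 occurs
in Z exactly r times more often than - 1. *)
Lemma closure_of_split m k (T : 'M[C]_(m + k)) (B : 'M[C]_m) (Z : 'M[C]_k) r :
  \tr T = r%:R -> similar_mx T (block_mx B 0 0 Z) -> balanced B ->
  spectrum Z `<=` [set -1; 1] -> (r <= dimker (Z - 1%:M)%R)%N ->
  norm_closure (@diff_idempotent_mx R (m + k)) T.
Proof.
move=> trT sT balB specZ kerZ.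
have [sB Bs] := eigenlist_exists B; have [sZ Zs] := eigenlist_exists Z.
have symB := iffLR (balancedP Bs) balB.
have [|p [q pq]] := @perm_nseq_pm1 sZ.
  by move=> a az; have := specZ a; rewrite (spectrumE Zs) => /(_ az)[]; [right|left].
have Ts := iffRL (eigenlist_similar _ sT) (eigenlist_ublock 0 Bs Zs).
have sums (a : C) j : \sum_(x <- nseq j a) x = j%:R * a.
  by rewrite big_nseq iter_addr_0 mulr_natl.
have pqr : p = (q + r)%N.
  have := trace_exp 1 Ts; rewrite expr1 trT big_cat /=.
  under eq_bigr do rewrite expr1.
  under [X in _ = _ + X -> _]eq_bigr do rewrite expr1.
  rewrite sum_symmetric // add0r (perm_big _ pq) big_cat /= !sums mulr1 mulrN1.
  by move/eqP; rewrite eq_sym subr_eq addrC -natrD eqr_nat => /eqP.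
apply: (@closure_of_eigenlist _ _ r (sB ++ nseq q 1 ++ nseq q (-1))).
- apply/(eigenlist_perm _ Ts); rewrite -catA perm_cat2l (perm_trans pq) // pqr.
  by rewrite nseqD -!catA perm_cat2l perm_catC.
- rewrite !map_cat !map_nseq opprK perm_cat //.
  by rewrite perm_catC.
have := similar_rank (similar_shift 1 sT).
rewrite scalar_mx_block opp_block_mx add_block_mx !subrr rank_diag_block_mx => ->.
rewrite -addnA leq_add ?rank_leq_row //.
by move: kerZ; rewrite dimkerE leq_subRL ?rank_leq_row.
Qed.
End Sufficiency.

(** * The conditions are closed *)

Section Necessity.
Variable R : realType.
Local Notation C := R[i].
Local Notation normc := Normc.normc.

Lemma continuous_mul (T : topologicalType) (f g : T -> C^o) :
  continuous f -> continuous g -> continuous (fun x => f x * g x : C^o).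
Proof. by move=> fc gc x; apply: cvgM; [exact: fc|exact: gc]. Qed.

Lemma continuous_add (T : topologicalType) (f g : T -> C^o) :
  continuous f -> continuous g -> continuous (fun x => f x + g x : C^o).
Proof. by move=> fc gc x; apply: cvgD; [exact: fc|exact: gc]. Qed.

Lemma continuous_const (T : topologicalType) (c : C) :
  continuous (fun _ : T => c : C^o).
Proof. by move=> x; apply: cvg_cst. Qed.

Lemma continuous_det (T : topologicalType) k (F : T -> 'M[C]_k) :
  (forall i j, continuous (fun x => F x i j : C^o)) ->
  continuous (fun x => \det (F x) : C^o).
Proof.
move=> Fc; apply: (@continuous_sum R T) => s.
apply: continuous_mul; first exact: continuous_const.
exact: (@continuous_prod R T).
Qed.

Lemma closure_nonzero n (S : set 'M[C]_n) (T : 'M[C]_n) (h : 'M[C^o]_n -> C^o) :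
  norm_closure S T -> continuous h -> h T != 0 ->
  exists X, [/\ S X, mx1norm (T - X) < 1 & h X != 0].
Proof.
move=> /norm_closureP cl hc hT.
have : nbhs (T : 'M[C^o]_n) (fun X => h X != 0).
  exact: cvgr_neq0 (hc T) hT.
move=> /nbhs_ballP[e /= e0 eb].
have [eR eE] : exists e' : R, e = e'%:C by apply/complex_realP; apply: gtr0_real.
have m0 : 0 < Num.min eR 1 by rewrite lt_min ltr01 andbT -ltcR -eE.
have [X SX NX] := cl _ m0.
exists X; split=> //; first by rewrite (lt_le_trans NX) // ge_min lexx orbT.
apply: eb; split=> // i j; rewrite /ball /= normCE eE ltcR.
have := normc_entry_le (T - X) i j; rewrite !mxE => /le_lt_trans; apply.
by rewrite (lt_le_trans NX) // ge_min lexx.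
Qed.

Lemma det_affine_continuous n k (c : 'M[C]_k) (L : 'M[C]_(k, n)) (Q : 'M[C]_(n, k)) :
  continuous (fun X : 'M[C^o]_n => \det (c + L *m X *m Q) : C^o).
Proof.
apply: continuous_det => i j.
have -> : (fun X : 'M[C^o]_n => (c + L *m X *m Q) i j : C^o) =
    (fun X => c i j + \sum_a \sum_b (L i b * Q a j) * X b a).
  apply/funext=> Y; rewrite !mxE; congr (_ + _); apply: eq_bigr => a _.
  by rewrite mxE mulr_suml; apply: eq_bigr => b _; rewrite mulrAC.
apply: continuous_add; first exact: continuous_const.
apply: (@continuous_sum R 'M[C^o]_n) => a; apply: (@continuous_sum R 'M[C^o]_n) => b.
exact: continuous_coef.
Qed.

(** Both sides are values of monic split polynomials, which agree at infinitely
many points. *)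
Lemma perm_opp_of_det n (T : 'M[C]_n) s r : eigenlist T s ->
  (forall t : C, t != 0 -> t - 1 != 0 -> t + 1 != 0 ->
    \det (t%:M - T) * (t + 1) ^+ r = (-1) ^+ n * \det ((- t)%:M - T) * (t - 1) ^+ r) ->
  perm_eq (s ++ nseq r (-1)) (map -%R s ++ nseq r 1).
Proof.
move=> Ts h; apply: prod_XsubC_eq; apply/eqP; rewrite -subr_eq0; apply: contraT.
set g := _ - _ => g0.
have detE t : \det (t%:M - T) = \prod_(a <- s) (t - a).
  by rewrite -horner_char_poly Ts horner_prod; apply: eq_bigr => a _; rewrite hornerXsubC.
have hg t : t != 0 -> t - 1 != 0 -> t + 1 != 0 -> root g t.
  move=> t0 t1 t2; have := h t t0 t1 t2; rewrite !detE (eigenlist_size Ts) => e.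
  rewrite rootE /g hornerD hornerN !horner_prod subr_eq0 !big_cat /= !big_nseq big_map.
  rewrite -!Monoid.iteropE !hornerXsubC opprK.
  under eq_bigr do rewrite hornerXsubC.
  under [X in _ == X * _]eq_bigr do rewrite hornerXsubC opprK.
  rewrite e; apply/eqP; congr (_ * _).
  elim: (s) => [|a u IH]; first by rewrite !big_nil mul1r.
  by rewrite !big_cons -IH /= exprS; ring.
have := max_poly_roots g0 (_ : all (root g) [seq k.+2%:R | k <- iota 0 (size g)]).
rewrite map_inj_uniq ?iota_uniq => [/(_ _ isT)|i j /eqP]; last first.
  by rewrite eqr_nat => /eqP[].
rewrite size_map size_iota ltnn; apply; apply/allP => _ /mapP[k _ ->]; apply: hg.
- by rewrite pnatr_eq0.
- by rewrite -(natr1 k.+1) addrK pnatr_eq0.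
- by rewrite natr1 pnatr_eq0.
Qed.

Lemma natr_dist_lt1 (a b : nat) : normc (a%:R - b%:R : C) < 1 -> a = b.
Proof.
have -> : (a%:R - b%:R : C) = (a%:R - b%:R)%:C by rewrite rmorphB /= !rmorph_nat.
rewrite normcR; wlog ab : a b / (a <= b)%N.
  by move=> H; case/orP: (leq_total a b) => [/H//|/H]; rewrite distrC => H' /H'.
rewrite distrC -natrB // normr_nat -[ltRHS]/(1%:R) ltr_nat ltnS leqn0 subn_eq0.
by move=> ba; apply/eqP; rewrite eqn_leq ab.
Qed.

Lemma normc_trace_le n (A : 'M[C]_n) : normc (\tr A) <= mx1norm A.
Proof.
rewrite (le_trans (normc_sum _)) //; apply: ler_sum => i _.
by rewrite (bigD1 i) //= lerDl sumr_ge0 // => *; apply: normc_ge0.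
Qed.

(** The trace of E - F is the integer \rank E - \rank F; at distance less than 1
from r it is equal to r. *)
Lemma diff_idempotent_near n (T X : 'M[C]_n) r : \tr T = r%:R ->
  diff_idempotent_mx X -> mx1norm (T - X) < 1 ->
  (\rank (X - 1%:M)%R + r <= n)%N /\
  (forall t : C, t != 0 -> t - 1 != 0 -> t + 1 != 0 ->
    \det (t%:M - X) * (t + 1) ^+ r = (-1) ^+ n * \det ((- t)%:M - X) * (t - 1) ^+ r).
Proof.
move=> trT [E EE [F FF <-]] NX.
have er : \rank E = (\rank F + r)%N.
  apply/esym/natr_dist_lt1; apply: le_lt_trans NX.
  apply: le_trans (normc_trace_le _).
  suff -> : \tr (T - (E - F)) = (\rank F + r)%:R - (\rank E)%:R by [].
  by rewrite !linearB /= trT !idempotent_trace // natrD; ring.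
split; last by move=> t *; apply: det_diff_idempotent_sym.
by have := rank_diff_idempotent F EE; rewrite er addnA addnAC leq_add2r.
Qed.

(** Each condition is expressed by the vanishing of continuous functions.  For
the rank, a nonzero minor of T - 1 of size exceeding n - r would remain nonzero
near T. *)
Lemma closure_necessary n (T : 'M[C]_n) r : \tr T = r%:R ->
  norm_closure (@diff_idempotent_mx R n) T ->
  (\rank (T - 1%:M)%R + r <= n)%N /\
  (forall t : C, t != 0 -> t - 1 != 0 -> t + 1 != 0 ->
    \det (t%:M - T) * (t + 1) ^+ r = (-1) ^+ n * \det ((- t)%:M - T) * (t - 1) ^+ r).
Proof.
move=> trT clT; split.
  apply: contraT; rewrite -ltnNge => lt.
  (* L (T - 1) Q = 1 exhibits an invertible minor of size k, up to a change of
     bases. *)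
  pose k := \rank (T - 1%:M).
  pose L : 'M[C]_(k, n) := pid_mx k *m invmx (col_ebase (T - 1%:M)).
  pose Q : 'M[C]_(n, k) := invmx (row_ebase (T - 1%:M)) *m pid_mx k.
  have LTQ : L *m (T - 1%:M) *m Q = 1%:M.
    rewrite -(mulmx_ebase (T - 1%:M)) /L /Q !mulmxA mulmxKV ?col_ebase_unit //.
    rewrite mulmxK ?row_ebase_unit // !pid_mx_id ?rank_leq_row // pid_mx_1 //.
  pose h (X : 'M[C^o]_n) : C^o := \det (- (L *m Q) + L *m X *m Q).
  have hE X : h X = \det (L *m (X - 1%:M) *m Q).
    by rewrite /h mulmxBr mulmxBl mulmx1 addrC.
  have [||X [DX NX]] := @closure_nonzero n _ T h clT.
  - exact: det_affine_continuous.
  - by rewrite hE LTQ det1 oner_neq0.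
  rewrite hE => hX; have [rX _] := diff_idempotent_near trT DX NX.
  suff : (k <= \rank (X - 1%:M)%R)%N.
    by move=> kX; have := leq_trans lt (leq_add kX (leqnn r)); rewrite ltnNge rX.
  have : L *m (X - 1%:M) *m Q \in unitmx by rewrite unitmxE unitfE.
  rewrite -row_free_unit => /eqP <-.
  by rewrite (leq_trans (mxrankM_maxl _ _)) // mxrankM_maxr.
move=> t t0 t1 t2; apply/eqP; rewrite -subr_eq0; apply: contraT => hT.
pose h (X : 'M[C^o]_n) : C^o := \det (t%:M - X) * (t + 1) ^+ r -
  (-1) ^+ n * \det ((- t)%:M - X) * (t - 1) ^+ r.
have dc (c : C) : continuous (fun X : 'M[C^o]_n => \det (c%:M - X) : C^o).
  have := @det_affine_continuous n n c%:M (- 1%:M) (1%:M : 'M[C]_n).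
  by under eq_fun do rewrite mulmx1 mulNmx mul1mx.
have [|X [DX NX]] := @closure_nonzero n _ T h clT _ hT.
  apply: continuous_add; first by apply: continuous_mul; [exact: dc|exact: continuous_const].
  have -> : (fun X : 'M[C^o]_n => - ((-1) ^+ n * \det ((- t)%:M - X) * (t - 1) ^+ r) : C^o) =
      (fun X => (- (-1) ^+ n * (t - 1) ^+ r) * \det ((- t)%:M - X)).
    by apply/funext=> X; ring.
  by apply: continuous_mul; [exact: continuous_const|exact: dc].
have [_ /(_ t t0 t1 t2) e] := diff_idempotent_near trT DX NX.
by rewrite /h e subrr eqxx.
Qed.

End Necessity.

Theorem theorem3p12 (R : realType) (n : nat) (T : 'M[R[i]]_n) (r : nat) :
  (0 < n)%N -> \tr T = r%:R ->
  (norm_closure (@diff_idempotent_mx R n) T <->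
   exists (m k : nat) (e : (m + k)%N = n) (B : 'M[R[i]]_m) (Z : 'M[R[i]]_k),
     [/\ simmx_in unitmx T (castmx (e, e) (block_mx B 0 0 Z)),
         balanced B,
         spectrum Z `<=` [set -1; 1]
       & (r <= dimker (Z - 1%:M))%N]).
Proof.
move=> _ trT; split=> [clT|[m [k [e [B [Z [/similar_simmx sT balB specZ kerZ]]]]]]]; last first.
  subst n; rewrite castmx_id in sT; exact: closure_of_split sT balB specZ kerZ.
have [rkT detT] := closure_necessary trT clT.
have [s Ts] := eigenlist_exists T.
have sym := perm_opp_of_det Ts detT.
pose d (a : R[i]) := (a != 1) && (a != -1).
have Ts' : eigenlist T ([seq a <- s | d a] ++ [seq a <- s | predC d a]).
  by apply/(eigenlist_perm _ Ts); rewrite perm_sym; apply: permEl; apply: perm_filterC.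
have [|m [k [B [Z [sT Bs Zs]]]]] := disjoint_split Ts'.
  by move=> a; rewrite !mem_filter => /andP[/negPf/= ->].
have e : (m + k)%N = n := esym (similar_dim sT).
have balB : balanced B.
  apply/(balancedP Bs); move: (perm_filter d sym).
  rewrite !filter_cat !filter_nseq /d /= !eqxx andbF !mul0n !cats0 filter_map.
  rewrite (@eq_filter _ (preim _ _) d) // => a /=.
  by rewrite eqr_oppLR eqr_opp andbC.
(* 1 is not an eigenvalue of B, so ker (T - 1) comes from Z. *)
have rkB : \rank (B - 1%:M) = m.
  apply: mxrank_unit; rewrite (eigenlist_unit _ Bs) mem_filter /d eqxx //.
exists m, k, e, B, Z; split=> //.
- by apply/similar_simmx; apply: similar_trans sT (similar_cast _ _).
- move=> a; rewrite (spectrumE Zs) /= mem_filter => /andP[/=].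
  by rewrite negb_and !negbK => /orP[/eqP ->|/eqP ->] _; [right|left].
have := similar_rank (similar_shift 1 sT).
rewrite scalar_mx_block opp_block_mx add_block_mx !subrr rank_diag_block_mx rkB => rkBZ.
by move: rkT; rewrite rkBZ -e -addnA leq_add2l dimkerE leq_subRL ?rank_leq_row.
Qed.
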